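(* Let $\varpi$ be the one-form $\varpi=\mathcal K\bigl(B,\mathrm{ad}_{A_0}^{-1}([dA_0,B])\bigr)$ on $\mathfrak g^*\times\mathfrak t_{\mathrm{reg}}\ni(B,A_0)$, viewed as a one-form on $\mathfrak t_{\mathrm{reg}}$ with coefficients in $S^2\mathfrak g$ (quadratic polynomials on $\mathfrak g^*$), and let $\phi:S\mathfrak g\to U\mathfrak g$ be the symmetrisation map. Then $$\phi(\varpi)=\sum_{\alpha\in\mathcal R_+}\frac{\mathcal K(\alpha,\alpha)}{2}\,(e_\alpha f_\alpha+f_\alpha e_\alpha)\,\frac{d\alpha}{\alpha}\ \in\ U\mathfrak g\otimes\Omega^1(\mathfrak t_{\mathrm{reg}}).$$
   Context: $\mathfrak g$ is a complex simple Lie algebra, $\mathfrak t\subset\mathfrak g$ a Cartan subalgebra, $\mathcal R\subset\mathfrak t^*$ the roots, $\mathcal R_+$ a choice of positive roots, $\mathfrak t_{\mathrm{reg}}=\{H\in\mathfrak t:\alpha(H)\ne0\ \forall\alpha\in\mathcal R\}$. $\mathcal K$ is the Killing form, used to identify $\mathfrak g^*$ with $\mathfrak g$ (so $B\in\mathfrak g^*$ is regarded as an element of $\mathfrak g$), and also denotes the induced bilinear form on $\mathfrak t^*$. $d$ is the exterior derivative on $\mathfrak t_{\mathrm{reg}}$; $[dA_0,B]$ takes values in $\bigoplus_{\alpha\in\mathcal R}\mathfrak g_\alpha$, on which $\mathrm{ad}_{A_0}$ is invertible. Quadratic polynomials on $\mathfrak g^*$ are identified with elements of $S^2\mathfrak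 g$; $S\mathfrak g$ and $U\mathfrak g$ are the symmetric algebra and the universal enveloping algebra. $\{e_\alpha,f_\alpha,h_\alpha\}$ is the usual Chevalley basis, with $e_\alpha\in\mathfrak g_\alpha$, $f_\alpha\in\mathfrak g_{-\alpha}$, normalised so that $[e_\alpha,f_\alpha]=h_\alpha$ (the coroot of $\alpha$). *)

(* Defs.v *)
From HB Require Import structures.
From mathcomp Require Import all_boot all_order all_algebra perm.
From mathcomp Require Import complex.
From mathcomp Require Import all_classical all_reals all_analysis.

Set Implicit Arguments.
Unset Strict Implicit.
Unset Printing Implicit Defensive.
Import Order.TTheory GRing.Theory Num.Theory.
Import passmx numFieldNormedType.Exports.
Local Open Scope classical_set_scope.
Local Open Scope complex_scope.
Local Open Scope ring_scope.

(* Associative algebras presented by generators and relations: formal algebra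
   expressions in letters from V, modulo a congruence. *)
Inductive aexp (K V : Type) : Type :=
| AGen of V
| AZero
| AOne
| AAdd of aexp K V & aexp K V
| AMul of aexp K V & aexp K V
| AScale of K & aexp K V.
Arguments AGen {K V} _.
Arguments AZero {K V}.
Arguments AOne {K V}.

HB.instance Definition _ (K V : Type) := gen_eqMixin (aexp K V).
HB.instance Definition _ (K V : Type) := gen_choiceMixin (aexp K V).

Section Envelope.
Variables (K : fieldType) (V : lmodType K) (br : V -> V -> V).
Local Notation exp := (aexp K V).

(* The least congruence making the quotient an associative unital K-algebra in
   which the letters depend linearly on V and satisfy x y - y x = br x y. *)
Inductive acong : exp -> exp -> Prop :=
| acong_refl a : acong a a
| acong_sym a b : acong a b -> acong b a
| acong_trans a b c : acong a b -> acong b c -> acong a c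
| acong_add a a' b b' : acong a a' -> acong b b' -> acong (AAdd a b) (AAdd a' b')
| acong_mul a a' b b' : acong a a' -> acong b b' -> acong (AMul a b) (AMul a' b')
| acong_scale k a a' : acong a a' -> acong (AScale k a) (AScale k a')
| acong_addA a b c : acong (AAdd a (AAdd b c)) (AAdd (AAdd a b) c)
| acong_addC a b : acong (AAdd a b) (AAdd b a)
| acong_add0 a : acong (AAdd AZero a) a
| acong_addN a : acong (AAdd (AScale (-1) a) a) AZero
| acong_mulA a b c : acong (AMul a (AMul b c)) (AMul (AMul a b) c)
| acong_mul1 a : acong (AMul AOne a) a
| acong_1mul a : acong (AMul a AOne) a
| acong_mulDl a b c : acong (AMul (AAdd a b) c) (AAdd (AMul a c) (AMul b c))
| acong_mulDr a b c : acong (AMul a (AAdd b c)) (AAdd (AMul a b) (AMul a c))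
| acong_scaleA k l a : acong (AScale k (AScale l a)) (AScale (k * l) a)
| acong_scale1 a : acong (AScale 1 a) a
| acong_scaleDr k a b : acong (AScale k (AAdd a b)) (AAdd (AScale k a) (AScale k b))
| acong_scaleDl k l a : acong (AScale (k + l) a) (AAdd (AScale k a) (AScale l a))
| acong_scaleAl k a b : acong (AScale k (AMul a b)) (AMul (AScale k a) b)
| acong_scaleAr k a b : acong (AScale k (AMul a b)) (AMul a (AScale k b))
| acong_gen k x y : acong (AGen (k *: x + y)) (AAdd (AScale k (AGen x)) (AGen y))
| acong_comm x y :
    acong (AMul (AGen x) (AGen y)) (AAdd (AMul (AGen y) (AGen x)) (AGen (br x y))).

Definition acongb : rel exp := fun a b => `[< acong a b >].

Lemma acongb_equiv : equiv_class_of acongb.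
Proof.
split=> [a|a b|b a c]; first by apply/asboolP; exact: acong_refl.
  by apply: asbool_equiv_eq; split; exact: acong_sym.
by move=> /asboolP ? /asboolP ?; apply/asboolP; apply: acong_trans; eassumption.
Qed.
Canonical acongb_equivrel := EquivRelPack acongb_equiv.

(* For br a Lie bracket this is the universal enveloping algebra T(V) / (x y - y x - br x y);
   the universal property is given by the env_lift lemmas below. *)
Definition envelope := {eq_quot acongb}%qT.
HB.instance Definition _ := Choice.on envelope.

Definition env_class (a : exp) : envelope := (\pi_({eq_quot acongb}%qT) a)%qT.
Definition env_repr (u : envelope) : exp := repr (u : {eq_quot acongb}%qT).

Lemma env_reprK : cancel env_repr env_class. Proof. exact: reprK. Qed.

Lemma envW (P : envelope -> Prop) : (forall a, P (env_class a)) -> forall u, P u.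
Proof. by move=> Pa u; rewrite -[u]env_reprK; exact: Pa. Qed.

Lemma pi_acong a b : acong a b <-> env_class a = env_class b.
Proof.
split=> [ab|]; first by apply/eqmodP/asboolP.
by move=> /eqmodP /asboolP.
Qed.

Lemma repr_acong a : acong (env_repr (env_class a)) a.
Proof. by apply/pi_acong; rewrite env_reprK. Qed.

Definition env_zero : envelope := env_class AZero.
Definition env_one : envelope := env_class AOne.
Definition env_add (u v : envelope) : envelope := env_class (AAdd (env_repr u) (env_repr v)).
Definition env_mul (u v : envelope) : envelope := env_class (AMul (env_repr u) (env_repr v)).
Definition env_scale k (u : envelope) : envelope := env_class (AScale k (env_repr u)).

Lemma pi_add a b : env_add (env_class a) (env_class b) = env_class (AAdd a b).
Proof. by apply/pi_acong/acong_add; exact: repr_acong. Qed.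
Lemma pi_mul a b : env_mul (env_class a) (env_class b) = env_class (AMul a b).
Proof. by apply/pi_acong/acong_mul; exact: repr_acong. Qed.
Lemma pi_scale k a : env_scale k (env_class a) = env_class (AScale k a).
Proof. by apply/pi_acong/acong_scale; exact: repr_acong. Qed.

Local Ltac epi := rewrite -?[env_zero]/(env_class AZero) -?[env_one]/(env_class AOne)
  !(pi_add, pi_mul, pi_scale); apply/pi_acong.

Lemma env_addA : associative env_add.
Proof. by elim/envW=> a; elim/envW=> b; elim/envW=> c; epi; constructor. Qed.
Lemma env_addC : commutative env_add.
Proof. by elim/envW=> a; elim/envW=> b; epi; constructor. Qed.
Lemma env_add0 : left_id env_zero env_add.
Proof. by elim/envW=> a; epi; constructor. Qed.
Lemma env_addN : left_inverse env_zero (env_scale (-1)) env_add.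
Proof. by elim/envW=> a; epi; constructor. Qed.
HB.instance Definition _ := GRing.isZmodule.Build envelope
  env_addA env_addC env_add0 env_addN.

Lemma env_mulA : associative env_mul.
Proof. by elim/envW=> a; elim/envW=> b; elim/envW=> c; epi; constructor. Qed.
Lemma env_mul1 : left_id env_one env_mul.
Proof. by elim/envW=> a; epi; constructor. Qed.
Lemma env_1mul : right_id env_one env_mul.
Proof. by elim/envW=> a; epi; constructor. Qed.
Lemma env_mulDl : left_distributive env_mul env_add.
Proof. by elim/envW=> a; elim/envW=> b; elim/envW=> c; epi; constructor. Qed.
Lemma env_mulDr : right_distributive env_mul env_add.
Proof. by elim/envW=> a; elim/envW=> b; elim/envW=> c; epi; constructor. Qed.

Fixpoint aeval (A : lalgType K) (f : V -> A) (a : exp) : A :=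
  match a with
  | AGen x => f x
  | AZero => 0
  | AOne => 1
  | AAdd a b => aeval f a + aeval f b
  | AMul a b => aeval f a * aeval f b
  | AScale k a => k *: aeval f a
  end.

Lemma aeval_acong (A : algType K) (f : V -> A) : linear f ->
    (forall x y, f x * f y = f y * f x + f (br x y)) ->
  forall a b, acong a b -> aeval f a = aeval f b.
Proof.
move=> flin fbr a b; elim=> //=.
- by move=> ? ? ? _ -> _ ->.
- by move=> ? ? ? ? _ -> _ ->.
- by move=> ? ? ? ? _ -> _ ->.
- by move=> ? ? ? _ ->.
- by move=> *; rewrite addrA.
- by move=> *; rewrite addrC.
- by move=> *; rewrite add0r.
- by move=> *; rewrite scaleN1r addNr.
- by move=> *; rewrite mulrA.
- by move=> *; rewrite mul1r.
- by move=> *; rewrite mulr1.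
- by move=> *; rewrite mulrDl.
- by move=> *; rewrite mulrDr.
- by move=> *; rewrite scalerA.
- by move=> *; rewrite scale1r.
- by move=> *; rewrite scalerDr.
- by move=> *; rewrite scalerDl.
- by move=> *; rewrite scalerAl.
- by move=> *; rewrite scalerAr.
Qed.

Lemma env_one_neq0 : env_one != env_zero.
Proof.
have lin0 : linear ((fun=> 0) : V -> K^o) by move=> k x y; rewrite scaler0 addr0.
apply/eqP => /pi_acong/(@aeval_acong K^o _ lin0)/eqP.
by rewrite /= oner_eq0 => H; apply: notF; apply: H => x y; rewrite mulr0 addr0.
Qed.
HB.instance Definition _ := GRing.Zmodule_isNzRing.Build envelope
  env_mulA env_mul1 env_1mul env_mulDl env_mulDr env_one_neq0.

Lemma env_scaleA k l u : env_scale k (env_scale l u) = env_scale (k * l) u.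
Proof. by elim/envW: u => a; epi; constructor. Qed.
Lemma env_scale1 : left_id 1 env_scale.
Proof. by elim/envW=> a; epi; constructor. Qed.
Lemma env_scaleDr : right_distributive env_scale env_add.
Proof. by move=> k; elim/envW=> a; elim/envW=> b; epi; constructor. Qed.
Lemma env_scaleDl u : {morph env_scale^~ u : k l / k + l >-> env_add k l}.
Proof. by move=> k l; elim/envW: u => a; epi; constructor. Qed.
HB.instance Definition _ := GRing.Zmodule_isLmodule.Build K envelope
  env_scaleA env_scale1 env_scaleDr env_scaleDl.

Lemma env_scaleAl k (u v : envelope) : k *: (u * v) = (k *: u) * v.
Proof.
elim/envW: u => a; elim/envW: v => b.
rewrite -![_ * _]/(env_mul _ _) -![_ *: _]/(env_scale _ _).
by epi; constructor.
Qed.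
HB.instance Definition _ := GRing.Lmodule_isLalgebra.Build K envelope env_scaleAl.
Lemma env_scaleAr k (u v : envelope) : k *: (u * v) = u * (k *: v).
Proof.
elim/envW: u => a; elim/envW: v => b.
rewrite -![_ * _]/(env_mul _ _) -![_ *: _]/(env_scale _ _).
by epi; constructor.
Qed.
HB.instance Definition _ := GRing.Lalgebra_isAlgebra.Build K envelope env_scaleAr.

Definition env_gen (x : V) : envelope := env_class (AGen x).

Lemma env_gen_linear : linear env_gen.
Proof.
move=> k x y; rewrite -![_ + _ in RHS]/(env_add _ _) -![_ *: env_gen _]/(env_scale _ _).
by rewrite /env_gen; epi; constructor.
Qed.
HB.instance Definition _ :=
  GRing.isLinear.Build K V envelope _ env_gen env_gen_linear.

Lemma env_gen_comm x y :
  env_gen x * env_gen y = env_gen y * env_gen x + env_gen (br x y).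
Proof.
rewrite -[_ + _]/(env_add _ _) -![_ * _]/(env_mul _ _).
by rewrite /env_gen; epi; constructor.
Qed.


Lemma env_classD a b : env_class (AAdd a b) = env_class a + env_class b.
Proof. by rewrite -pi_add. Qed.
Lemma env_classM a b : env_class (AMul a b) = env_class a * env_class b.
Proof. by rewrite -pi_mul. Qed.
Lemma env_classZ k a : env_class (AScale k a) = k *: env_class a.
Proof. by rewrite -pi_scale. Qed.

Section Lift.
Variables (A : algType K) (f : V -> A).

Definition env_lift (u : envelope) : A := aeval f (env_repr u).

Hypotheses (flin : linear f)
  (fbr : forall x y, f x * f y = f y * f x + f (br x y)).

Lemma env_lift_class a : env_lift (env_class a) = aeval f a.
Proof. exact/aeval_acong/repr_acong. Qed.

Lemma env_lift_gen x : env_lift (env_gen x) = f x.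
Proof. exact: env_lift_class. Qed.

Lemma env_lift_linear : linear env_lift.
Proof.
move=> k; elim/envW=> a; elim/envW=> b.
by rewrite -env_classZ -env_classD !env_lift_class.
Qed.

Lemma env_lift_monoid_morphism : monoid_morphism env_lift.
Proof.
split; first exact: (env_lift_class AOne).
by elim/envW=> a; elim/envW=> b; rewrite -env_classM !env_lift_class.
Qed.

Lemma env_lift_unique (h : {lrmorphism envelope -> A}) :
  (forall x, h (env_gen x) = f x) -> forall u, h u = env_lift u.
Proof.
move=> hf; elim/envW=> a; rewrite env_lift_class; elim: a => //=.
- exact: raddf0.
- exact: rmorph1.
- by move=> a IHa b IHb; rewrite env_classD raddfD /= IHa IHb.
- by move=> a IHa b IHb; rewrite env_classM rmorphM /= IHa IHb.
- by move=> k a IHa; rewrite env_classZ linearZ /= IHa.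
Qed.

End Lift.
End Envelope.

Arguments env_gen {K V} br x.

Section Symmetrisation.
Variables (K : fieldType) (V : lmodType K).

(* For the zero bracket the defining relation reads x y = y x. *)
Definition symalg := envelope (fun _ _ : V => 0).
HB.instance Definition _ := GRing.Algebra.on symalg.

Definition sgen : V -> symalg := env_gen (fun _ _ : V => 0).

Lemma sgenC x y : sgen x * sgen y = sgen y * sgen x.
Proof. by rewrite [LHS]env_gen_comm linear0 addr0. Qed.

(* The linear extension to formal expressions of a function F on words. *)
Fixpoint alin (W : lmodType K) (F : seq V -> W) (a : aexp K V) : W :=
  match a with
  | AGen x => F [:: x]
  | AZero => 0
  | AOne => F [::]
  | AAdd a b => alin F a + alin F b
  | AMul a b => alin (fun w => alin (fun w' => F (w ++ w')) b) a
  | AScale k a => k *: alin F a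
  end.

Section Alin.
Variable W : lmodType K.
Implicit Types F G : seq V -> W.

Lemma alin_ext F G : F =1 G -> alin F =1 alin G.
Proof. by move=> /funext ->. Qed.

Lemma alin_lin k F G a :
  alin (fun w => k *: F w + G w) a = k *: alin F a + alin G a.
Proof.
elim: a F G => //=.
- by move=> *; rewrite scaler0 addr0.
- by move=> a IHa b IHb F G; rewrite IHa IHb scalerDr addrACA.
- move=> a IHa b IHb F G; rewrite -IHa; apply: alin_ext => w; exact: IHb.
- by move=> l a IHa F G; rewrite IHa scalerDr !scalerA mulrC.
Qed.

Lemma alinZ k F a : alin (fun w => k *: F w) a = k *: alin F a.
Proof.
have := alin_lin k F (fun=> 0) a; under alin_ext do rewrite addr0.
move=> ->; suff -> : alin (fun=> 0 : W) a = 0 by rewrite addr0.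
have := alin_lin (-1) (fun=> 0) (fun=> 0 : W) a.
by under alin_ext do rewrite scaler0 addr0; rewrite scaleN1r addNr.
Qed.

Lemma alinD F G a : alin (fun w => F w + G w) a = alin F a + alin G a.
Proof.
rewrite -[alin F a]scale1r -alin_lin.
by apply: alin_ext => w; rewrite scale1r.
Qed.

Lemma alin0 a : alin (fun=> 0 : W) a = 0.
Proof. by under alin_ext do rewrite -(scale0r 0); rewrite alinZ scale0r. Qed.

Definition wsym F := (forall u v k x y, F (u ++ (k *: x + y) :: v) =
    k *: F (u ++ x :: v) + F (u ++ y :: v)) /\
  (forall u v x y, F (u ++ x :: y :: v) = F (u ++ y :: x :: v)).

Lemma wsym_l F w : wsym F -> wsym (fun w' => F (w ++ w')).
Proof.
move=> [F1 F2]; split=> [u v k x y|u v x y]; first by rewrite !(catA w) F1.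
by rewrite !(catA w) F2.
Qed.

Lemma wsym_r F b : wsym F -> wsym (fun w => alin (fun w' => F (w ++ w')) b).
Proof.
move=> [F1 F2]; split=> [u v k x y|u v x y].
  rewrite -alin_lin; apply: alin_ext => w.
  by rewrite -!catA /= F1.
by apply: alin_ext => w; rewrite -!catA /= F2.
Qed.

Lemma alin_acong F a b : wsym F -> acong (fun _ _ : V => 0) a b ->
  alin F a = alin F b.
Proof.
move=> + ab; elim: ab F => //=.
- by move=> {}a {}b _ IH F /IH.
- by move=> {}a {}b c _ IH1 _ IH2 F sF; rewrite IH1 ?IH2.
- by move=> {}a a' {}b b' _ IH1 _ IH2 F sF; rewrite (IH1 F) ?(IH2 F).
- move=> {}a a' {}b b' _ IH1 _ IH2 F sF.
  rewrite (IH1 _ (wsym_r b sF)); apply: alin_ext => w.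
  exact/IH2/wsym_l.
- by move=> k {}a a' _ IH F sF; rewrite IH.
- by move=> *; rewrite addrA.
- by move=> *; rewrite addrC.
- by move=> *; rewrite add0r.
- by move=> *; rewrite scaleN1r addNr.
- move=> {}a {}b c F sF; apply: alin_ext => w; apply: alin_ext => w'.
  by apply: alin_ext => w''; rewrite catA.
- by move=> {}a F sF; apply: alin_ext => w; rewrite cats0.
- by move=> {}a {}b c F sF; rewrite -alinD.
- by move=> *; rewrite scalerA.
- by move=> *; rewrite scale1r.
- by move=> *; rewrite scalerDr.
- by move=> *; rewrite scalerDl.
- by move=> k {}a {}b F sF; rewrite -alinZ.
- by move=> k x y F [F1 _]; exact: (F1 [::] [::]).
- move=> x y F [F1 /(_ [::] [::] x y) /= F2]; rewrite F2.
  suff -> : F [:: 0] = 0 by rewrite addr0.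
  have := F1 [::] [::] (-1) 0 0; rewrite /= scaler0 addr0 => ->.
  by rewrite scaleN1r addNr.
Qed.

End Alin.

Variable br : V -> V -> V.

Definition sym_word (w : seq V) : envelope br :=
  (size w)`!%:R^-1 *:
    \sum_(s : 'S_(size w)) \prod_(i < size w) env_gen br w`_(s i).

Lemma sym_wordE n w : size w = n ->
  sym_word w = n`!%:R^-1 *: \sum_(s : 'S_n) \prod_(i < n) env_gen br w`_(s i).
Proof. by move=> <-. Qed.

Lemma sym_wordP : wsym sym_word.
Proof.
split=> [u v k x y|u v x y].
  have szn z : size (u ++ z :: v) = (size u + size v).+1 by rewrite size_cat addnS.
  rewrite !(sym_wordE (szn _)); move: (_.+1) (szn 0) => n n0.
  rewrite scalerA mulrC -scalerA -scalerDr; congr (_ *: _).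
  rewrite scaler_sumr -big_split /=; apply: eq_bigr => s _.
  have up : (size u < n)%N by rewrite -n0 size_cat /= addnS ltnS leq_addr.
  pose i0 := (s^-1 (Ordinal up))%g.
  have [r1 [r2 [enumE i1 i2]]] : exists r1 r2,
      [/\ index_enum 'I_n = r1 ++ i0 :: r2, i0 \notin r1 & i0 \notin r2].
    have := index_enum_uniq 'I_n; have := mem_index_enum i0.
    case/splitPr => r1 r2; rewrite cat_uniq /= negb_or.
    by case/and4P=> _ /andP[? _] ? _; exists r1, r2.
  have nthE z i : i != i0 -> (u ++ z :: v)`_(s i) = (u ++ 0 :: v)`_(s i).
    move=> ii0; rewrite !nth_cat; case: ltnP => // le_u_si.
    suff : (s i - size u)%N != 0%N by case: (_ - _)%N.
    rewrite subn_eq0 -ltnNge ltn_neqAle le_u_si andbT.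
    apply: contra ii0 => /eqP e; apply/eqP/(@perm_inj _ s).
    by rewrite permKV; apply: val_inj; rewrite /= e.
  have E z : \prod_(i < n) env_gen br (u ++ z :: v)`_(s i) =
      (\prod_(i <- r1) env_gen br (u ++ 0 :: v)`_(s i)) * env_gen br z *
      (\prod_(i <- r2) env_gen br (u ++ 0 :: v)`_(s i)).
    rewrite enumE big_cat big_cons /= mulrA.
    have -> : (u ++ z :: v)`_(s i0) = z.
      by rewrite permKV /= nth_cat ltnn subnn.
    congr (_ * _ * _); apply: eq_big_seq => i ir; rewrite nthE //;
      by apply: contraTneq ir => ->.
  by rewrite !E linearP /= mulrDr mulrDl -scalerAr -scalerAl.
have szn a b : size (u ++ a :: b :: v) = (size u + size v).+2.
  by rewrite size_cat /= !addnS.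
rewrite !(sym_wordE (szn _ _)); move: (_.+2) (szn 0 0) => n n0; congr (_ *: _).
have up : ((size u).+1 < n)%N by rewrite -n0 size_cat /= !addnS !ltnS leq_addr.
pose p := Ordinal (ltnW up); pose q := Ordinal up.
rewrite (reindex_inj (mulIg (tperm p q))) /=; apply: eq_bigr => s _.
apply: eq_bigr => i _; congr env_gen; rewrite permM.
case: tpermP => [->|->|].
- by rewrite !nth_cat /= ltnn subnn ltnNge leqnSn /= subSnn.
- by rewrite !nth_cat /= ltnn subnn ltnNge leqnSn /= subSnn.
move=> /eqP sp /eqP sq; rewrite !nth_cat; case: ltnP => // le_u_si.
suff : (1 < s i - size u)%N by case: (_ - _)%N => [|[]].
rewrite ltn_subRL addn1 ltn_neqAle eq_sym [(_ < s i)%N]ltn_neqAle le_u_si andbT.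
by rewrite [(size u == _)]eq_sym; apply/andP.
Qed.

(* The linear map characterised by symmetrisation_prod below. *)
Definition symmetrisation (s : symalg) : envelope br := alin sym_word (env_repr s).

Lemma symmetrisation_class a : symmetrisation (env_class _ a) = alin sym_word a.
Proof. exact/(alin_acong sym_wordP)/repr_acong. Qed.

Lemma symmetrisation_linear : linear symmetrisation.
Proof.
move=> k; elim/envW=> a; elim/envW=> b.
by rewrite -env_classZ -env_classD !symmetrisation_class.
Qed.
HB.instance Definition _ :=
  GRing.isLinear.Build K symalg (envelope br) _ symmetrisation symmetrisation_linear.

Lemma symmetrisation_prod n (x : 'I_n -> V) :
  symmetrisation (\prod_(i < n) sgen (x i)) =
  n`!%:R^-1 *: \sum_(s : 'S_n) \prod_(i < n) env_gen br (x (s i)).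
Proof.
pose a (r : seq 'I_n) := foldr (fun i => @AMul K V (AGen (x i))) AOne r.
have aE r : env_class (fun _ _ : V => 0) (a r) = \prod_(i <- r) sgen (x i).
  elim: r => [|i r IHr] /=; first by rewrite big_nil.
  by rewrite env_classM IHr big_cons.
have alinE (F : seq V -> envelope br) r : alin F (a r) = F [seq x i | i <- r].
  by elim: r F => [|i r IHr] F //=; rewrite IHr.
have enumE : index_enum 'I_n = enum 'I_n.
  by rewrite /index_enum; case: index_enum_key; rewrite -enumT.
rewrite [in LHS]enumE -aE symmetrisation_class alinE (@sym_wordE n).
  congr (_ *: _); apply: eq_bigr => s _; apply: eq_bigr => i _; congr env_gen.
  by rewrite (nth_map (s i)) ?size_enum_ord ?nth_ord_enum.
by rewrite size_map size_enum_ord.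
Qed.

End Symmetrisation.

HB.mixin Record Vector_isLie (K : fieldType) L of Vector K L := {
  lie : L -> L -> L;
  lie_linear_left : forall k x y z, lie (k *: x + y) z = k *: lie x z + lie y z;
  lie_linear_right : forall k x y z, lie z (k *: x + y) = k *: lie z x + lie z y;
  lie_alternating : forall x, lie x x = 0;
  lie_jacobi : forall x y z, lie x (lie y z) + lie y (lie z x) + lie z (lie x y) = 0
}.

#[short(type="lieAlgType")]
HB.structure Definition LieAlgebra (K : fieldType) :=
  {L of Vector_isLie K L & Vector K L}.

Notation uea g := (envelope (@lie _ g)).
Notation ugen x := (env_gen (@lie _ _) x).

Section LieTheory.
Variables (K : fieldType) (g : lieAlgType K).
Local Notation dual V := 'Hom(V, K^o).

Lemma lie_is_linear (x : g) : linear (lie x).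
Proof. by move=> k y z; rewrite lie_linear_right. Qed.
HB.instance Definition _ (x : g) :=
  GRing.isLinear.Build K g g _ (lie x) (lie_is_linear x).

Definition ad (x : g) : 'End(g) := linfun (lie x).

Definition lfun_trace (V : vectType K) (h : 'End(V)) : K :=
  \tr (mxof (vbasis {:V}) (vbasis {:V}) h).

Definition killing (x y : g) : K := lfun_trace (ad x \o ad y)%VF.

Lemma killing_is_linear (x : g) : linear (killing x : g -> K^o).
Proof.
move=> k y z; rewrite /killing /lfun_trace.
suff -> : (ad x \o ad (k *: y + z))%VF = k *: (ad x \o ad y)%VF + (ad x \o ad z)%VF.
  by rewrite !linearP.
apply/lfunP=> w; rewrite !lfunE /= !lfunE /= !lfunE /= ?lfunE /=.
by rewrite lie_linear_left linearP.
Qed.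
HB.instance Definition _ (x : g) :=
  GRing.isLinear.Build K g K^o _ (killing x : g -> K^o) (killing_is_linear x).

Definition lie_simple :=
  ~ (forall x y : g, lie x y = 0) /\
  forall I : {vspace g}, (forall x y, y \in I -> lie x y \in I) ->
    I = 0%VS \/ I = fullv.

Definition ad_diagonalizable (x : g) :=
  exists2 b : seq g, basis_of fullv b & {in b, forall v, exists k, lie x v = k *: v}.

(* Cartan subalgebras of a semisimple Lie algebra over an algebraically closed
   field of characteristic 0: abelian, consisting of ad-semisimple elements, and
   equal to their own centraliser. *)
Definition cartan_subalgebra (t : {vspace g}) :=
  [/\ {in t &, forall x y, lie x y = 0},
      {in t, forall x, ad_diagonalizable x} &
      forall x, {in t, forall h, lie h x = 0} -> x \in t].

(* x |-> killing x -, and the resulting identification of the dual of g with g. *)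
Definition killing_iso : 'Hom(g, dual g) := linfun (fun x => linfun (killing x : g -> K^o)).
Definition sharp (B : dual g) : g := (killing_iso^-1)%VF B.

Section Cartan.
Variable t : {vspace g}.
Implicit Types (a : dual (subvs_of t)) (h : subvs_of t).

Definition root_space a : {vspace g} :=
  lker (linfun (fun x => linfun (fun h => lie (vsval h) x - (a h : K) *: x))).

Lemma root_spaceP a x :
  reflect (forall h, lie (vsval h) x = (a h : K) *: x) (x \in root_space a).
Proof.
pose F x h : g := lie (vsval h) x - (a h : K) *: x.
have F1 y : linear (F y).
  move=> k h h'; rewrite /F !linearP /= lie_linear_left scalerDl scalerBr.
  by rewrite scalerA opprD addrACA.
pose F1l y := GRing.isLinear.Build _ _ _ _ (F y) (F1 y).
pose F1L y : {linear _ -> _} := HB.pack (F y) (F1l y).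
pose G y : 'Hom(subvs_of t, g) := linfun (F y).
have F2 : linear G.
  move=> k y z; apply/lfunP=> h; rewrite add_lfunE scale_lfunE /G.
  rewrite (lfunE (F1L _)) (lfunE (F1L y)) (lfunE (F1L z)) /= /F lie_linear_right.
  by rewrite scalerDr scalerBr !scalerA mulrC opprD addrACA.
pose F2l := GRing.isLinear.Build _ _ _ _ G F2.
pose F2L : {linear _ -> _} := HB.pack G F2l.
rewrite memv_ker (lfunE F2L) /=; apply: (iffP eqP) => [/lfunP Fx h|Fx].
  by apply/eqP; rewrite -subr_eq0; move: (Fx h); rewrite (lfunE (F1L x)) zero_lfunE => /= /eqP.
by apply/lfunP=> h; rewrite (lfunE (F1L x)) zero_lfunE /= /F Fx subrr.
Qed.

Definition roots : set (dual (subvs_of t)) :=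
  [set a | a != 0 /\ root_space a != 0%VS].

Definition positive_system (P : set (dual (subvs_of t))) :=
  [/\ P `<=` roots,
      forall a, roots a -> P a \/ P (- a),
      forall a, ~ (P a /\ P (- a)) &
      forall a b, P a -> P b -> roots (a + b) -> P (a + b)].

Definition regular : set (subvs_of t) := [set h | forall a, roots a -> a h != 0].

(* The restriction of the Killing form to t identifies the dual of t with t,
   hence induces the bilinear form killing_dual. *)
Definition killing_iso_t : 'Hom(subvs_of t, dual (subvs_of t)) :=
  linfun (fun h => linfun (fun h' => killing (vsval h) (vsval h') : K^o)).
Definition sharp_t a : subvs_of t := (killing_iso_t^-1)%VF a.
Definition killing_dual a b : K := killing (vsval (sharp_t a)) (vsval (sharp_t b)).

Definition coroot a : g := (2 / killing_dual a a) *: vsval (sharp_t a).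

Definition root_sum : {vspace g} := \big[addv/0%VS]_(a \in roots) root_space a.

(* ad h restricted to the sum of the root spaces, and the inverse of this
   endomorphism (for h regular), applied to elements of that sum. *)
Definition ad_root_sum h : 'End(subvs_of root_sum) :=
  linfun (fun y => vsproj root_sum (lie (vsval h) (vsval y))).
Definition ad_inv h (y : g) : g :=
  vsval (((ad_root_sum h)^-1)%VF (vsproj root_sum y)).

End Cartan.
End LieTheory.

Section Forms.
Variable K : numFieldType.
Local Notation dual V := 'Hom(V, K^o).

(* A finite-dimensional space carries no canonical norm; differentiability and
   differentials are taken in coordinates and do not depend on the basis. *)
Definition coords (V : vectType K) (v : V) : 'rV[K]_(\dim {:V}) :=
  rVof (vbasis {:V}) v.

Definition in_coords (V W : vectType K) (F : V -> W) :
    'rV[K]_(\dim {:V}) -> 'rV[K]_(\dim {:W}) :=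
  @coords W \o F \o vecof (vbasis {:V}).

(* extd F h x is the value of dF at the point h on the tangent vector x. *)
Definition extd (V W : vectType K) (F : V -> W) (h x : V) : W :=
  vecof (vbasis {:W}) ('d (in_coords F) (coords h) (coords x)).

Variables (g : lieAlgType K) (t : {vspace g}).

(* An M-valued one-form on the regular part of t: omega h x is its value at
   the point h on the tangent vector x; only regular h are meaningful. *)
Definition one_form (M : lmodType K) := subvs_of t -> subvs_of t -> M.

Definition holomorphic_form (eta : one_form K^o) :=
  forall h, regular h ->
    linear (eta h) /\ forall x, differentiable (in_coords (eta^~ x)) (coords h).

Definition otimes (M : lmodType K) (u : M) (eta : one_form K^o) : one_form M :=
  fun h x => (eta h x : K) *: u.

(* omega belongs to (span of N) tensor (holomorphic one-forms). *)
Definition in_tensor_forms (M : lmodType K) (N : set M) (omega : one_form M) :=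
  exists (n : nat) (u : 'I_n -> M) (eta : 'I_n -> one_form K^o),
    [/\ forall i, N (u i), forall i, holomorphic_form (eta i) &
        forall h x, regular h -> omega h x = \sum_(i < n) otimes (u i) (eta i) h x].

Definition dlog (a : dual (subvs_of t)) : one_form K^o :=
  fun h x => (a h : K)^-1 * (extd a h x : K).

(* In varpi the differential dA_0 is that of the inclusion of t into g. *)
Definition varpi (B : dual g) : one_form K^o := fun h x =>
  killing (sharp B) (ad_inv h (lie (extd (vsval : subvs_of t -> g) h x) (sharp B))).

Definition sym2 : set (symalg g) := [set s | exists (n : nat) (x y : 'I_n -> g),
  s = \sum_(i < n) sgen (x i) * sgen (y i)].

(* An element of the symmetric algebra as a polynomial function on the dual of g. *)
Definition poly_eval (s : symalg g) (B : dual g) : K := env_lift (B : g -> K^o) s.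

Definition represents_varpi (omega : one_form (symalg g)) :=
  in_tensor_forms sym2 omega /\
  forall h x, regular h -> poly_eval (omega h x) =1 (fun B => varpi B h x).

End Forms.

(* Main.v *)
(* In a basis of simultaneous eigenvectors of the Cartan subalgebra, the
   operators ad x, for x a root vector, shift weights by a nonzero amount and are
   therefore nilpotent.  Following a string of weights from a lowest weight
   vector then shows that every weight takes a half-integer multiple of the
   value a(h) at h = [x, y], for x and y of weights a and -a.  This yields the
   non-degeneracy of the Killing form, because K(h, h) is a sum of squares, as
   well as K(a, a) <> 0 and the fact that root spaces are lines.  Hence an
   element s of g is, modulo t, the sum over the positive roots a of
     K(s, f_a) / K(e_a, f_a) e_a + K(s, e_a) / K(e_a, f_a) f_a,
   with K(e_a, f_a) = 2 / K(a, a), and the one-form varpi is represented by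
   sum_a K(a, a) e_a f_a da / a.  A quadratic element of the symmetric algebra is
   determined by the polynomial function it induces, and the symmetrisation of
   e_a f_a is (e_a f_a + f_a e_a) / 2. *)
Require Import Defs.
From HB Require Import structures.
From mathcomp Require Import all_boot all_order all_algebra fingroup perm complex.
From mathcomp Require Import finmap ring.
From mathcomp Require Import all_classical all_reals all_analysis.
Set Implicit Arguments.
Unset Strict Implicit.
Unset Printing Implicit Defensive.
Import Order.TTheory GRing.Theory Num.Theory.
Import passmx numFieldNormedType.Exports.
Local Open Scope classical_set_scope.
Local Open Scope complex_scope.
Local Open Scope ring_scope.

(** * Traces in an arbitrary basis and invariance of the Killing form *)

Section LfunTrace.
Variables (K : fieldType) (V : vectType K).

(** A change of basis conjugates the matrix of [h], and cyclicity of the trace removes the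
    conjugation. This allows Killing traces to be computed in a basis of weight vectors. *)
Lemma lfun_trace_basis (e : (\dim {:V}).-tuple V) (h : 'End(V)) :
  basis_of fullv e -> lfun_trace h = \sum_i coord e i (h e`_i).
Proof.
move=> eb; pose b := vbasis {:V}; have bb : basis_of fullv b by exact: vbasisP.
have E : mxof b b h = mxof b e \1%VF *m mxof e e h *m mxof e b \1%VF.
  by rewrite -!mxof_comp // comp_lfun1l comp_lfun1r.
rewrite /lfun_trace -/b E mxtrace_mulC mulmxA -mxof_comp // comp_lfun1l.
rewrite mxof1 ?(basis_free eb) // mul1mx /mxtrace.
by apply: eq_bigr => i _; rewrite !mxE /= vecof_delta.
Qed.

Lemma lfun_traceC (h k : 'End(V)) : lfun_trace (h \o k)%VF = lfun_trace (k \o h)%VF.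
Proof. by rewrite /lfun_trace !(mxof_comp _ _ (vbasisP fullv)) mxtrace_mulC. Qed.

Lemma lfun_traceB (h k : 'End(V)) : lfun_trace (h - k) = lfun_trace h - lfun_trace k.
Proof. by rewrite /lfun_trace !linearB. Qed.

End LfunTrace.

Section LieIdentities.
Variables (K : fieldType) (g : lieAlgType K).
Implicit Types x y z : g.

Lemma lieDl x y z : lie (x + y) z = lie x z + lie y z.
Proof. by have := lie_linear_left 1 x y z; rewrite !scale1r. Qed.

Lemma lie0l z : lie 0 z = 0 :> g.
Proof. by apply: (addrI (lie 0 z)); rewrite -lieDl !addr0. Qed.

Lemma lieZl k x z : lie (k *: x) z = k *: lie x z.
Proof. by have := lie_linear_left k x 0 z; rewrite lie0l !addr0. Qed.

Lemma lieC x y : lie x y = - lie y x.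
Proof.
apply/eqP; rewrite -addr_eq0; have := lie_alternating (x + y).
by rewrite lieDl !linearD /= !lie_alternating addr0 add0r => ->.
Qed.

Lemma lie_lie x y z : lie (lie x y) z = lie x (lie y z) - lie y (lie x z).
Proof.
have /eqP := lie_jacobi x y z; rewrite addr_eq0 => /eqP E.
by rewrite lieC -E [lie z x]lieC linearN.
Qed.

Lemma adE x y : ad x y = lie x y. Proof. by rewrite lfunE. Qed.

Lemma ad_lie x y : ad (lie x y) = (ad x \o ad y)%VF - (ad y \o ad x)%VF.
Proof.
apply/lfunP => z.
by rewrite add_lfunE opp_lfunE !comp_lfunE !adE lie_lie.
Qed.

Lemma killingC x y : killing x y = killing y x.
Proof. exact: lfun_traceC. Qed.

(** With brackets expanded as commutators, both sides contain tr(XYZ); the remaining terms tr(YXZ)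
    and tr(XZY) agree by cyclicity. *)
Lemma killing_invariant x y z : killing (lie x y) z = killing x (lie y z).
Proof.
rewrite /killing !ad_lie comp_lfunDl comp_lfunDr comp_lfunNl comp_lfunNr.
rewrite !lfun_traceB comp_lfunA -!comp_lfunA; congr (_ - _).
by rewrite [LHS]lfun_traceC -comp_lfunA.
Qed.

Lemma killingDl x y z : killing (x + y) z = killing x z + killing y z.
Proof. by rewrite ![killing _ z]killingC linearD. Qed.
Lemma killingZl k x z : killing (k *: x) z = k * killing x z.
Proof. by rewrite ![killing _ z]killingC linearZ. Qed.
Lemma killing0l z : killing (0 : g) z = 0.
Proof. by rewrite killingC linear0. Qed.
Lemma killingNl x z : killing (- x) z = - killing x z.
Proof. by rewrite ![killing _ z]killingC linearN. Qed.
Lemma killingZr k x z : killing z (k *: x) = k * killing z x.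
Proof. exact: linearZ. Qed.

Lemma killing_isoE x y : (killing_iso g x : 'Hom(g, K^o)) y = killing x y.
Proof.
(* [linfun] evaluates to the given function only once that function is known to be linear, so the
   linear structure is built explicitly. *)
have F1 : linear (fun x => linfun (killing x : g -> K^o)).
  move=> k u v; apply/lfunP => z; rewrite add_lfunE scale_lfunE !lfunE /=.
  by rewrite killingDl killingZl.
pose F1l := GRing.isLinear.Build _ _ _ _ _ F1.
pose F1L : {linear _ -> _} := HB.pack (fun x => linfun (killing x : g -> K^o)) F1l.
by rewrite /killing_iso (lfunE F1L) /= lfunE.
Qed.

End LieIdentities.

(** * Ideals of a simple Lie algebra: the centre and the Killing radical *)

Section SimpleLie.
Variables (K : fieldType) (g : lieAlgType K) (g_simple : lie_simple g).

(** The line through a central [z] is an ideal; were it all of [g], then [g] would be abelian. *)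
Lemma simple_center (z : g) : (forall y, lie z y = 0) -> z = 0.
Proof.
move=> cz; have [nab /(_ <[z]>%VS) []] := g_simple.
- by move=> x y /vlineP[k ->]; rewrite linearZ /= lieC cz oppr0 scaler0 mem0v.
- by move=> z0; apply/eqP; rewrite -memv0 -z0 memv_line.
move=> zf; case: nab => x y.
have /vlineP[k ->] : x \in <[z]>%VS by rewrite zf memvf.
by rewrite lieZl cz scaler0.
Qed.

(* The radical of the Killing form is an ideal. *)
Lemma simple_killing_dichotomy :
  (forall x y : g, killing x y = 0) \/ lker (killing_iso g) = 0%VS.
Proof.
have [nab /(_ (lker (killing_iso g))) []] := g_simple.
- move=> x y; rewrite !memv_ker => /eqP /lfunP y0; apply/eqP/lfunP => z.
  rewrite killing_isoE lieC killingNl killing_invariant.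
  by rewrite -killing_isoE y0 !zero_lfunE oppr0.
- by right.
move=> rf; left => x y; have : x \in lker (killing_iso g) by rewrite rf memvf.
by rewrite memv_ker => /eqP /lfunP /(_ y); rewrite killing_isoE zero_lfunE.
Qed.

End SimpleLie.

(** * Simultaneous eigenvectors of the Cartan subalgebra *)

Section WeightBasis.
Variables (K : fieldType) (g : lieAlgType K) (t : {vspace g}).
Local Notation n := (\dim {:g}).

(** Passes from an eigenbasis to the matrix form of diagonalisability: the rows of [P] are the
    coordinates of the eigenvectors. *)
Lemma ad_diagonalizable_mx (x : g) : ad_diagonalizable x ->
  mxpoly.diagonalizable (mxof (vbasis {:g}) (vbasis {:g}) (ad x)).
Proof.
move=> [c cb ceig]; set b := vbasis _; have bb : basis_of fullv b := vbasisP _.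
have sc : size c == n.
  by rewrite -(eqP (basis_free cb)) (span_basis cb).
pose c' := Tuple sc; have cb' : basis_of fullv c' by [].
pose P := mxof c' b \1%VF.
have Pu : P \in unitmx.
  have /mulmx1_unit[] // : P *m mxof b c' \1%VF = 1%:M.
  by rewrite -mxof_comp // comp_lfun1l mxof1 ?(basis_free cb').
have [d dE] : exists d : 'rV[K]_n, forall i : 'I_n, lie x c'`_i = d 0 i *: c'`_i.
  have e (i : 'I_n) : exists k, lie x c'`_i = k *: c'`_i.
    by apply: ceig; apply: mem_nth; rewrite size_tuple.
  have [d dE] := boolp.choice e.
  by exists (\row_i d i) => i; rewrite mxE.
exists P => //; apply/diagonalizable_forPex; exists d; apply/(simmxP Pu).
have rP i : row i P = rVof b c'`_i by rewrite rowE mul_mxof // vecof_delta id_lfunE.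
apply/row_matrixP => i; rewrite !row_mul rP row_diag_mx -scalemxAl -rowE rP.
by rewrite -rVof_app // adE dE linearZ.
Qed.

Lemma weight_basis (t_cartan : cartan_subalgebra t) :
  exists (v : n.-tuple g) (w : 'I_n -> 'Hom(subvs_of t, K^o)), basis_of fullv v /\
    forall (i : 'I_n) h, lie (vsval h) v`_i = (w i h : K) *: v`_i.
Proof.
have [tab tdiag _] := t_cartan.
pose b := vbasis {:g}; have bb : basis_of fullv b := vbasisP _.
pose A (h : subvs_of t) := mxof b b (ad (vsval h)).
(* The matrices of [ad h], for [h] in a finite basis of [t], commute because [t] is abelian, hence
   are diagonalised by one [P]; its rows give the weight vectors. *)
have [P Pu /allP PA] : mxpoly.codiagonalizable [seq A h | h <- vbasis {:subvs_of t}].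
  apply/mxpoly.codiagonalizableP.
  split=> [_ _ /mapP[h _ ->] /mapP[k _ ->]|_ /mapP[h _ ->]]; last first.
    exact/ad_diagonalizable_mx/tdiag/subvsP.
  rewrite /comm_mx /A -!mxof_comp //; congr mxof; apply/lfunP => z.
  apply/eqP; rewrite !comp_lfunE !adE -subr_eq0 -lie_lie.
  by rewrite (tab _ _ (subvsP k) (subvsP h)) lie0l.
have Pd (h : subvs_of t) : h \in vbasis {:subvs_of t} ->
    exists d : 'rV[K]_n, P *m A h = diag_mx d *m P.
  move=> hb; have /PA /diagonalizable_forPex[d] : A h \in [seq A h | h <- vbasis {:subvs_of t}].
    exact: map_f.
  by move=> /(simmxP Pu); exists d.
pose v := [tuple vecof b (row i P) | i < n].
have vE (i : 'I_n) : v`_i = vecof b (row i P) by rewrite -tnth_nth tnth_mktuple.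
have vb : basis_of fullv v.
  rewrite basisEdim size_tuple leqnn andbT; apply/subvP => x _.
  rewrite -[x](rVofK bb) -[rVof b x](mulmxKV Pu) mulmx_sum_row linear_sum.
  apply: memv_suml => i _; rewrite linearZ /= memvZ // -vE memv_span //.
  by rewrite mem_nth // size_tuple.
have ex (i : 'I_n) (h : subvs_of t) : exists k : K, lie (vsval h) v`_i = k *: v`_i.
  rewrite (coord_vbasis (memvf h)); elim/big_ind: _ => [|x y [k kx] [l ly]|j _].
  - by exists 0; rewrite linear0 lie0l scale0r.
  - by exists (k + l); rewrite linearD lieDl kx ly scalerDl.
  have [|d dE] := Pd (vbasis {:subvs_of t})`_j.
    by rewrite mem_nth // size_tuple.
  exists (coord (vbasis {:subvs_of t}) j h * d 0 i).
  rewrite linearZ lieZl -scalerA; congr (_ *: _); rewrite vE -adE (hom_vecof b bb).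
  by rewrite -/(A _) -row_mul dE row_mul row_diag_mx -scalemxAl -rowE linearZ.
(* Reading the eigenvalue off as a coordinate makes it linear in [h]. *)
pose w0 (i : 'I_n) (h : subvs_of t) : K^o := coord v i (lie (vsval h) v`_i).
have w0l i : linear (w0 i).
  by move=> k x y; rewrite /w0 linearP lie_linear_left linearP.
pose wl i := GRing.isLinear.Build _ _ _ _ _ (w0l i).
pose wL i : {linear _ -> _} := HB.pack (w0 i) (wl i).
exists v, (fun i => linfun (w0 i)); split=> // i h; rewrite (lfunE (wL i)) /= /w0.
have [k ->] := ex i h; congr (_ *: _).
by rewrite linearZ /= coord_free ?(basis_free vb) // eqxx mulr1.
Qed.

End WeightBasis.

(** * Weights and root strings *)

Section RootDecomposition.
Variables (K : numFieldType) (g : lieAlgType K) (t : {vspace g}).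
Hypotheses (g_simple : lie_simple g) (t_cartan : cartan_subalgebra t).
Local Notation n := (\dim {:g}).
Local Notation weight := ('Hom(subvs_of t, K^o)).
Variables (v : n.-tuple g) (w : 'I_n -> weight).
Hypotheses (vb : basis_of fullv v)
  (vw : forall (i : 'I_n) h, lie (vsval h) v`_i = (w i h : K) *: v`_i).
Implicit Types (a b : weight) (h : subvs_of t) (x y z : g).

Lemma root_space_basis (i : 'I_n) : v`_i \in root_space (w i).
Proof. by apply/root_spaceP. Qed.

Lemma coord_lie h x i : coord v i (lie (vsval h) x) = (w i h : K) * coord v i x.
Proof.
rewrite {1}(coord_basis vb (memvf x)) linear_sum.
under eq_bigr => j _ do rewrite linearZ /= vw scalerA mulrC -scalerA.
rewrite linear_sum (bigD1 i) //= big1 ?addr0 => [|j ji].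
  by rewrite !linearZ /= coord_free ?(basis_free vb) // eqxx mulr1.
by rewrite !linearZ /= coord_free ?(basis_free vb) // (negPf ji) !mulr0.
Qed.

(** The [i]-th coordinate of [lie h x] is both [w i h] and [a h] times that of [x]. *)
Lemma coord_root_space a x i : x \in root_space a -> coord v i x != 0 -> w i = a.
Proof.
move=> /root_spaceP xa xi; apply/lfunP => h; apply: (mulIf xi).
by rewrite -coord_lie xa linearZ.
Qed.

Lemma root_space_weight a x : x \in root_space a -> x != 0 -> exists i, w i = a.
Proof.
move=> xa x0; have [i xi] : exists i, coord v i x != 0.
  apply: contrapT => /forallNP H; move/eqP: x0; apply.
  rewrite (coord_basis vb (memvf x)) big1 // => i _.
  by have /negP := H i; rewrite negbK => /eqP ->; rewrite scale0r.
by exists i; apply: coord_root_space xi.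
Qed.

(** One inclusion is commutativity of [t], the other that [t] is its own centraliser. *)
Lemma root_space0 x : (x \in t) = (x \in root_space (0 : weight)).
Proof.
have [tab _ tc] := t_cartan; apply/idP/root_spaceP => [xt h|x0].
  by rewrite zero_lfunE scale0r tab ?subvsP.
apply: tc => h ht; have := x0 (vsproj t h).
by rewrite vsprojK // zero_lfunE scale0r.
Qed.

Lemma root_space_lie a b x y :
  x \in root_space a -> y \in root_space b -> lie x y \in root_space (a + b).
Proof.
move=> /root_spaceP xa /root_spaceP yb; apply/root_spaceP => h.
have -> : lie (vsval h) (lie x y) =
    lie (lie (vsval h) x) y + lie x (lie (vsval h) y).
  by rewrite lie_lie subrK.
by rewrite xa yb lieZl linearZ /= -scalerDl add_lfunE.
Qed.

Lemma root_space_vsval a x h : x \in root_space a ->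
  lie x (vsval h) = - (a h : K) *: x.
Proof. by move=> /root_spaceP xa; rewrite lieC xa scaleNr. Qed.

Lemma linear_basis_eq0 (V : lmodType K) (F : {linear g -> V}) :
  (forall i : 'I_n, F v`_i = 0) -> forall x, F x = 0.
Proof.
move=> Fv x; rewrite (coord_basis vb (memvf x)) linear_sum big1 // => i _.
by rewrite linearZ /= Fv scaler0.
Qed.

Lemma iter_lie_root a b x z (k : nat) :
  x \in root_space a -> z \in root_space b ->
  iter k (lie x) z \in root_space (b + a *+ k).
Proof.
move=> xa zb; elim: k => [|k IHk]; first by rewrite mulr0n addr0.
by rewrite mulrS addrCA; apply: root_space_lie.
Qed.

(* The iterates lie in root spaces for pairwise distinct weights. *)
Lemma iter_lie_nilpotent a b x z : a != 0 ->
  x \in root_space a -> z \in root_space b -> exists k, iter k (lie x) z = 0.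
Proof.
move=> a0 xa zb; apply: contrapT => /forallNP N.
have wk (k : nat) : exists i, w i = b + a *+ k.
  by apply: root_space_weight (iter_lie_root k xa zb) _; exact/eqP/N.
have [c cE] := boolp.choice wk.
(* If no iterate vanished, [n + 1] distinct weights [b + k a] would occur among the [n] weights of
   the basis. *)
have c_inj : injective (fun k : 'I_n.+1 => c k).
  move=> k l /(congr1 w); rewrite !cE => /addrI /eqP ckl; apply/val_inj/eqP => /=.
  apply: contraT => kl; move: ckl.
  wlog lk : k l kl / (l < k)%N => [H|].
    move: (kl); rewrite neq_ltn => /orP[lt|lt ckl]; last exact: (H k l).
    by rewrite eq_sym => ckl; apply: (H l k) => //; rewrite eq_sym.
  rewrite -subr_eq0 -mulrnBr 1?ltnW // -(scaler_nat _ a) scaler_eq0 (negPf a0) orbF.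
  by rewrite pnatr_eq0 subn_eq0 leqNgt lk.
by have := leq_card _ c_inj; rewrite !card_ord ltnn.
Qed.

Lemma weight_shift a b (k : nat) h :
  ((b + a *+ k) h : K) = (b h : K) + k%:R * (a h : K).
Proof. by rewrite add_lfunE -(scaler_nat _ a) scale_lfunE. Qed.

(** * Strings through a triple [x], [y], [h], where [a h] is not normalised and may vanish *)

Section Triple.
Variables (a : weight) (x y : g) (h : subvs_of t).
Hypotheses (a0 : a != 0) (xa : x \in root_space a) (ya : y \in root_space (- a))
  (xyh : lie x y = vsval h).

(** Moving [y] past each [x] costs [- h], acting on weights [b], [b + a], up to [b + k a]; the
    coefficient is minus the sum of their values at [h]. *)
Lemma lie_iter_raise b z (k : nat) : z \in root_space b -> lie y z = 0 ->
  lie y (iter k.+1 (lie x) z) =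
    - (k.+1%:R * (b h : K) + 'C(k.+1, 2)%:R * (a h : K)) *: iter k (lie x) z.
Proof.
move=> zb yz; elim: k => [|k IHk].
  have -> : lie y (iter 1 (lie x) z) = lie x (lie y z) - lie (lie x y) z.
    by rewrite lie_lie opprB addrC subrK.
  by rewrite yz linear0 xyh (root_spaceP _ _ zb) mul1r mul0r addr0 sub0r scaleNr.
have zk := iter_lie_root k.+1 xa zb.
have -> : lie y (iter k.+2 (lie x) z) =
    lie x (lie y (iter k.+1 (lie x) z)) - lie (lie x y) (iter k.+1 (lie x) z).
  by rewrite lie_lie opprB addrC subrK.
rewrite IHk xyh (root_spaceP _ _ zk) linearZ /= -scalerBl; congr (_ *: _).
rewrite weight_shift [in RHS]binS bin1 natrD -(natr1 k.+1); ring.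
Qed.

(** Let [m + 1] be the least number of applications of [x] that kills [z], positive since [z] is
    nonzero. The coefficient in [lie_iter_raise] at [k = m] must then vanish, and division by
    [m + 1] gives the value. *)
Lemma lowest_weight b z : z != 0 -> z \in root_space b -> lie y z = 0 ->
  exists m : nat, (b h : K) = - (m%:R / 2) * (a h : K).
Proof.
move=> z0 zb yz.
have ex : exists k, iter k (lie x) z == 0.
  by have [k kz] := iter_lie_nilpotent a0 xa zb; exists k; apply/eqP.
case: (ex_minnP ex) => -[|m] /eqP zm zmin; first by case/eqP: z0.
exists m; have := lie_iter_raise m zb yz; rewrite zm linear0 => /esym/eqP.
rewrite scaler_eq0 => /orP[|/zmin]; last by rewrite ltnn.
rewrite oppr_eq0 => /eqP E.
have m0 : m.+1%:R != 0 :> K by rewrite pnatr_eq0.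
have C2 : 'C(m.+1, 2)%:R = m.+1%:R * m%:R / 2 :> K.
  apply: (canRL (mulfK _)); rewrite ?pnatr_eq0 // -!natrM; congr _%:R.
  by rewrite mulnC -mul_bin_diag bin1.
apply: (mulfI m0); apply/subr0_eq; by rewrite -[RHS]E C2; field.
Qed.

(** Applying [y] as long as the result is nonzero, say [m] times, reaches a lowest weight vector of
    weight [b - m a], whose value at [h] is [- (l / 2) a h]. *)
Lemma weight_real_multiple b z : z != 0 -> z \in root_space b ->
  exists2 r : K, r \is Num.real & (b h : K) = r * (a h : K).
Proof.
move=> z0 zb; have na0 : - a != 0 by rewrite oppr_eq0.
have ex : exists k, iter k (lie y) z == 0.
  by have [k kz] := iter_lie_nilpotent na0 ya zb; exists k; apply/eqP.
case: (ex_minnP ex) => -[|m] /eqP zm zmin; first by case/eqP: z0.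
have zm0 : iter m (lie y) z != 0 by apply/negP => /zmin; rewrite ltnn.
have [l] := lowest_weight zm0 (iter_lie_root m ya zb) zm.
rewrite weight_shift opp_lfunE => E.
exists (m%:R - l%:R / 2).
  by rewrite rpredB ?rpred_div ?realn.
rewrite mulrBl -mulNr -E; ring.
Qed.

End Triple.

(** * The Killing form through weights, and its non-degeneracy *)

Lemma killing_weights h h' :
  killing (vsval h) (vsval h') = \sum_i (w i h : K) * (w i h' : K).
Proof.
rewrite /killing (lfun_trace_basis _ vb); apply: eq_bigr => i _.
rewrite comp_lfunE !adE vw linearZ /= vw !linearZ /=.
by rewrite coord_free ?(basis_free vb) // eqxx mulr1 mulrC.
Qed.

Lemma weights_eq0 h : (forall i, w i h = 0) -> h = 0.
Proof.
move=> wh; apply: val_inj; apply: (simple_center g_simple) => z /=.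
apply: (linear_basis_eq0 (F := lie (vsval h))) => i.
by rewrite /= vw wh scale0r.
Qed.

Lemma rootsP a : Defs.roots a <-> a != 0 /\ exists i, w i = a.
Proof.
split=> -[a0 ar]; split=> //.
  move: ar; rewrite -vpick0 => /root_space_weight; apply; exact: memv_pick.
have [i wi] := ar; apply/eqP => r0; have := root_space_basis i.
by rewrite wi r0 memv0 => /eqP vi; have := basis_not0 vb (mem_tnth i v);
  rewrite (tnth_nth 0) vi eqxx.
Qed.

Lemma basis_neq0 (i : 'I_n) : v`_i != 0.
Proof. by have := basis_not0 vb (mem_tnth i v); rewrite (tnth_nth 0). Qed.

Lemma roots_weight i : w i != 0 -> Defs.roots (w i).
Proof. by move=> wi; apply/rootsP; split=> //; exists i. Qed.

(** All weights take multiples of [a h = 0] at [h], so [h] is central. *)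
Lemma triple_degenerate a x y h : a != 0 -> x \in root_space a ->
  y \in root_space (- a) -> lie x y = vsval h -> a h = 0 -> h = 0.
Proof.
move=> a0 xa ya xyh ah; apply: weights_eq0 => i.
have [r _ ->] := weight_real_multiple a0 xa ya xyh (basis_neq0 i) (root_space_basis i).
by rewrite ah mulr0.
Qed.

(** Here K(h, h) is [a h] squared times a sum of squares of real numbers. If [a h] were nonzero,
    every ratio would vanish, including that of the weight [a] itself. *)
Lemma triple_isotropic a x y h : Defs.roots a -> x \in root_space a ->
  y \in root_space (- a) -> lie x y = vsval h ->
  killing (vsval h) (vsval h) = 0 -> h = 0.
Proof.
move=> /rootsP[a0 [j wj]] xa ya xyh; rewrite killing_weights => /eqP hh.
apply: (triple_degenerate a0 xa ya xyh); apply/eqP/contraT => ah.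
have R i : exists r : K, r \is Num.real /\ (w i h : K) = r * (a h : K).
  have [r] := weight_real_multiple a0 xa ya xyh (basis_neq0 i) (root_space_basis i).
  by exists r.
have [r rE] := boolp.choice R.
move: hh; under eq_bigr => i _ do rewrite (rE i).2 mulrACA -expr2.
rewrite -mulr_suml mulf_eq0 mulf_eq0 (negPf ah) orbb orbF psumr_eq0 => [/allP|i _].
  move=> /(_ j (mem_index_enum j)) /=; rewrite sqrf_eq0 => /eqP rj.
  by have := (rE j).2; rewrite wj rj mul0r => /eqP; rewrite (negPf ah).
by rewrite -realEsqr; have [] := rE i.
Qed.

(** A description by coordinates of the sum of the root spaces; see [root_sumE]. *)
Definition nonzero_weight_part : {vspace g} := (\sum_(i | w i != 0%R) <[v`_i]>)%VS.

Lemma nonzero_weight_partP x :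
  reflect (forall i, w i = 0 -> coord v i x = 0) (x \in nonzero_weight_part).
Proof.
apply: (iffP memv_sumP) => [[u uv ->] i wi|H].
  rewrite linear_sum big1 // => j wj; have /vlineP[k ->] := uv j wj.
  rewrite linearZ /= coord_free ?(basis_free vb) //.
  by case: (eqVneq j i) wj => [->|_ _]; rewrite ?wi ?eqxx ?mulr0.
exists (fun i => coord v i x *: v`_i) => [i _|]; first by rewrite memvZ ?memv_line.
rewrite {1}(coord_basis vb (memvf x)) (bigID (fun i => w i == 0)) /= big1 ?add0r //.
by move=> i /eqP /H ->; rewrite scale0r.
Qed.

Lemma root_space_nonzero a x : a != 0 -> x \in root_space a -> x \in nonzero_weight_part.
Proof.
move=> a0 xa; apply/nonzero_weight_partP => i wi; apply/eqP; apply: contraNT a0.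
by move=> /(coord_root_space xa) <-; rewrite wi.
Qed.

(* If the Killing form vanished, brackets of opposite root vectors would vanish,
   making the sum of the root spaces an ideal complementary to t. *)
Lemma simple_killing_neq0 : exists x y : g, killing x y != 0.
Proof.
apply: contrapT => N; have K0 x y : killing x y = 0.
  by apply: contrapT => /eqP xy; apply: N; exists x, y.
have [tab _ _] := t_cartan; have [nab gid] := g_simple.
(* Only opposite weights could give a bracket inside [t]; that bracket is isotropic since the
   Killing form is assumed zero, hence it vanishes. *)
have brV (i j : 'I_n) : w j != 0 -> lie v`_i v`_j \in nonzero_weight_part.
  move=> wj; have brij := root_space_lie (root_space_basis i) (root_space_basis j).
  have [wij0|wij] := eqVneq (w i + w j) 0; last exact: root_space_nonzero brij.
  have brt : lie v`_i v`_j \in t by rewrite root_space0 -wij0.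
  have wij : w i = - w j by apply/eqP; rewrite -addr_eq0 wij0.
  have brh : lie v`_i v`_j = vsval (vsproj t (lie v`_i v`_j)) by rewrite vsprojK.
  have wi : w i != 0 by rewrite wij oppr_eq0.
  have vj : v`_j \in root_space (- w i) by rewrite wij opprK root_space_basis.
  have := triple_isotropic (roots_weight wi) (root_space_basis i) vj brh (K0 _ _).
  by move=> br0; rewrite brh br0 linear0 mem0v.
have [|V0|V1] := gid nonzero_weight_part.
- move=> x y yV; rewrite (coord_basis vb (memvf y)) linear_sum memv_suml // => j _.
  rewrite linearZ /=; have [wj|wj] := eqVneq (w j) 0.
    by move/nonzero_weight_partP: yV => ->; rewrite ?scale0r ?mem0v.
  rewrite memvZ // (coord_basis vb (memvf x)) lieC memvN linear_sum memv_suml // => i _.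
  by rewrite linearZ /= memvZ // lieC memvN brV.
(* If the ideal is zero, [t] is all of [g], which is then abelian. *)
- have tf x : x \in t.
    rewrite (coord_basis vb (memvf x)) memv_suml // => i _.
    rewrite memvZ // root_space0; suff <- : w i = 0 by exact: root_space_basis.
    apply/eqP; apply: contraT => wi; have := basis_neq0 i.
    by rewrite -memv0 -V0 (root_space_nonzero wi) ?root_space_basis.
  by apply: nab => x y; apply: tab.
(* If the ideal is everything, no weight vanishes, so [t] is zero; but every functional on a zero
   space vanishes, so the basis is empty. *)
have w0 i : w i != 0.
  apply/negP => /eqP wi; have /nonzero_weight_partP/(_ i wi) : v`_i \in nonzero_weight_part.
    by rewrite V1 memvf.
  by rewrite coord_free ?(basis_free vb) // eqxx => /eqP; rewrite oner_eq0.
have h0 h : h = 0.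
  apply: val_inj => /=; rewrite (coord_basis vb (memvf (vsval h))) big1 // => i _.
  have := subvsP h; rewrite root_space0 => /coord_root_space ht.
  have [->|/ht wi] := eqVneq (coord v i (vsval h)) 0; first by rewrite scale0r.
  by have := w0 i; rewrite wi eqxx.
apply: nab => x y; rewrite (coord_basis vb (memvf y)) linear_sum big1 // => i _.
by have /eqP[] := w0 i; apply/lfunP => h; rewrite (h0 h) !linear0.
Qed.

Lemma killing_nondegenerate x : (forall y, killing x y = 0) -> x = 0.
Proof.
move=> x0; have [K0|ker0] := simple_killing_dichotomy g_simple.
  by have [y [z]] := simple_killing_neq0; rewrite K0 eqxx.
apply/eqP; rewrite -memv0 -ker0 memv_ker; apply/eqP/lfunP => y.
by rewrite killing_isoE x0 zero_lfunE.
Qed.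

(** Non-degeneracy makes [killing_iso] injective, and equality of dimensions makes it onto, so
    [sharp] is a genuine inverse. *)
Lemma sharpK (B : 'Hom(g, K^o)) y : killing (sharp B) y = B y.
Proof.
rewrite -killing_isoE /sharp limg_lfunVK //.
suff -> : limg (killing_iso g) = fullv by exact: memvf.
apply/eqP; rewrite eqEdim subvf limg_dim_eq.
  by rewrite !dimvf /dim /= muln1.
apply/eqP; rewrite -subv0; apply/subvP => x.
rewrite memv_cap memv_ker memv0 => /andP[_ /eqP/lfunP xK]; apply/eqP.
by apply: killing_nondegenerate => z; rewrite -killing_isoE xK zero_lfunE.
Qed.

(** Invariance applied to [x], [h], [y] gives (a + b)(h) K(x, y) = 0 for all [h]. *)
Lemma killing_orthogonal a b x y : x \in root_space a -> y \in root_space b ->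
  a + b != 0 -> killing x y = 0.
Proof.
move=> xa yb; apply: contraNeq => xy; apply/eqP/lfunP => h.
have := killing_invariant x (vsval h) y.
rewrite (root_space_vsval h xa) (root_spaceP _ _ yb) killingZl killingZr.
by rewrite add_lfunE zero_lfunE => /(mulIf xy) <-; rewrite subrr.
Qed.

(** The zero weight space [t] is orthogonal to all vectors of nonzero weight, so being orthogonal to
    [t] already means being orthogonal to [g]. *)
Lemma killing_cartan_nondegenerate h :
  (forall h', killing (vsval h) (vsval h') = 0) -> h = 0.
Proof.
move=> hh; apply: val_inj; apply: killing_nondegenerate.
apply: (linear_basis_eq0 (F := killing (vsval h))) => i /=.
have [wi|wi] := eqVneq (w i) 0.
  have vt : v`_i \in t by rewrite root_space0 -wi root_space_basis.
  by rewrite -(vsprojK vt) hh.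
have ht : vsval h \in root_space (0 : weight) by rewrite -root_space0 subvsP.
by apply: killing_orthogonal ht (root_space_basis i) _; rewrite add0r.
Qed.

Lemma killing_iso_tE h h' : (killing_iso_t t h : weight) h' = killing (vsval h) (vsval h').
Proof.
have F0 (u : subvs_of t) : linear (fun h' : subvs_of t => killing (vsval u) (vsval h') : K^o).
  by move=> k x y; rewrite !linearP.
pose F0l (u : subvs_of t) := GRing.isLinear.Build _ _ _ _ _ (F0 u).
pose F0L (u : subvs_of t) : {linear _ -> _} := HB.pack
  (fun h' : subvs_of t => killing (vsval u) (vsval h') : K^o) (F0l u).
have F1 : linear (fun u => linfun (F0L u)).
  move=> k x y; apply/lfunP => z; rewrite add_lfunE scale_lfunE !lfunE /=.
  by rewrite killingDl killingZl.
pose F1l := GRing.isLinear.Build _ _ _ _ _ F1.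
pose F1L : {linear _ -> _} := HB.pack (fun u => linfun (F0L u)) F1l.
by rewrite /killing_iso_t (lfunE F1L) /= (lfunE (F0L h)).
Qed.

Lemma sharp_tK a h : killing (vsval (sharp_t a)) (vsval h) = a h.
Proof.
rewrite -killing_iso_tE /sharp_t limg_lfunVK //.
suff -> : limg (killing_iso_t t) = fullv by exact: memvf.
apply/eqP; rewrite eqEdim subvf limg_dim_eq.
  by rewrite !dimvf /dim /= muln1.
apply/eqP; rewrite -subv0; apply/subvP => x.
rewrite memv_cap memv_ker memv0 => /andP[_ /eqP/lfunP xK]; apply/eqP.
by apply: killing_cartan_nondegenerate => z; rewrite -killing_iso_tE xK zero_lfunE.
Qed.

Lemma killing_dualE a : killing_dual a a = a (sharp_t a).
Proof. exact: sharp_tK. Qed.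

(** * Root vectors: brackets of opposite ones, K(a, a), and root spaces as lines *)

Lemma lie_opposite a x y : x \in root_space a -> y \in root_space (- a) ->
  lie x y = killing x y *: vsval (sharp_t a).
Proof.
move=> xa ya; have xyt : lie x y \in t.
  by have := root_space_lie xa ya; rewrite subrr -root_space0.
rewrite -(vsprojK xyt) -linearZ; congr vsval; apply/subr0_eq.
apply: killing_cartan_nondegenerate => h.
rewrite linearB linearZ /= killingDl killingZl killingNl sharp_tK vsprojK //.
rewrite killing_invariant (root_space_vsval h ya) killingZr opp_lfunE opprK.
by rewrite mulrN mulrC subrr.
Qed.

(** By non-degeneracy a root vector pairs nontrivially with some [y] of weight [- a]. Their bracket
    is a nonzero multiple of [sharp_t a]; if [a] vanished there, [triple_degenerate] would force
    [sharp_t a = 0] and [a = 0]. *)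
Lemma killing_dual_neq0 a : Defs.roots a -> killing_dual a a != 0.
Proof.
move=> ar; have [a0 [i wi]] := (rootsP a).1 ar.
have xa : v`_i \in root_space a by rewrite -wi root_space_basis.
have [y ya xy] : exists2 y, y \in root_space (- a) & killing v`_i y != 0.
  apply: contrapT => N; move/eqP: (basis_neq0 i); apply.
  apply: killing_nondegenerate; apply: (linear_basis_eq0 (F := killing v`_i)) => j /=.
  have [/eqP|aj] := eqVneq (a + w j) 0.
    rewrite addr_eq0 -eqr_oppLR => /eqP aj.
    apply: contrapT => /eqP xj; apply: N; exists v`_j => //.
    by rewrite aj root_space_basis.
  by apply: killing_orthogonal xa (root_space_basis j) aj.
rewrite killing_dualE; apply: contraNneq a0 => at0.
have xyh : lie v`_i y = vsval (killing v`_i y *: sharp_t a).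
  by rewrite (lie_opposite xa ya).
have := triple_degenerate ((rootsP a).1 ar).1 xa ya xyh.
rewrite linearZ /= at0 scaler0 => /(_ erefl)/eqP.
rewrite scaler_eq0 (negPf xy) => /eqP ta0; apply/eqP/lfunP => h.
by rewrite -sharp_tK ta0 linear0 killing0l zero_lfunE.
Qed.

(** The difference [u] is orthogonal to [y], so it commutes with [y] and would be a lowest weight
    vector of weight [a]. Then (1 + m / 2) a(h) = 0 for some natural [m], which is impossible unless
    [u = 0]. *)
Lemma root_space_line a x y z : Defs.roots a ->
  x \in root_space a -> y \in root_space (- a) -> killing x y != 0 ->
  z \in root_space a -> z = (killing z y / killing x y) *: x.
Proof.
move=> ar xa ya xy za; have [a0 _] := ar; apply/subr0_eq; set u := z - _.
have ua : u \in root_space a by rewrite memvB // memvZ.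
have uy : killing u y = 0 by rewrite killingDl killingNl killingZl divfK // subrr.
have yu : lie y u = 0 by rewrite lieC (lie_opposite ua ya) uy scale0r oppr0.
have xyh : lie x y = vsval (killing x y *: sharp_t a) by rewrite (lie_opposite xa ya).
apply/eqP; apply: contraT => u0.
have [m /eqP] := lowest_weight a0 xa xyh u0 ua yu.
rewrite -subr_eq0 mulNr opprK -[X in X + _]mul1r -mulrDl mulf_eq0.
rewrite linearZ /= mulf_eq0 (negPf xy) -killing_dualE (negPf (killing_dual_neq0 ar)) /=.
by rewrite orbF gt_eqF // ltr_wpDr ?ltr01 // divr_ge0.
Qed.

Lemma killing_coroot a x y : Defs.roots a ->
  x \in root_space a -> y \in root_space (- a) -> lie x y = coroot a ->
  killing x y = 2 / killing_dual a a.
Proof.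
move=> ar xa ya; rewrite (lie_opposite xa ya) /coroot => /eqP.
rewrite -subr_eq0 -scalerBl scaler_eq0 subr_eq0 => /orP[/eqP //|/eqP ta].
by have := killing_dual_neq0 ar; rewrite /killing_dual ta killing0l eqxx.
Qed.

(** * The sum of the root spaces and the inverse of ad on it *)

Lemma finite_roots : finite_set (Defs.roots (t := t)).
Proof.
apply: (@sub_finite_set _ _ [set w i | i in [set: 'I_n]]).
  by move=> a /rootsP[_ [i <-]]; exists i.
exact/finite_image/finite_finset.
Qed.

Lemma root_space_sub_root_sum a : Defs.roots a -> (root_space a <= root_sum t)%VS.
Proof.
move=> ar; rewrite /root_sum (fsbigD1 a) ?addvSl //.
by move: finite_roots; apply: sub_finite_set => b [].
Qed.

Lemma root_sumE : root_sum t = nonzero_weight_part.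
Proof.
apply/eqP; rewrite eqEsubv; apply/andP; split; last first.
  apply/subv_sumP => i wi; apply: subv_trans (root_space_sub_root_sum (roots_weight wi)).
  by rewrite -memvE root_space_basis.
rewrite /root_sum (fsbig_finite _ _ finite_roots) /=.
rewrite big_seq; elim/big_ind: _ => [||a]; first exact: sub0v.
  by move=> x y xV yV; rewrite subv_add xV.
rewrite (in_fset_set finite_roots) => /set_mem[a0 _].
by apply/subvP => x; apply: root_space_nonzero.
Qed.

(** On the sum of the root spaces [ad h] is diagonal with entries [w i h], nonzero at a regular [h];
    it is thus injective and its inverse cancels it. *)
Lemma ad_inv_lie h z : regular h -> z \in root_sum t ->
  ad_inv h (lie (vsval h) z) = z.
Proof.
move=> hr zs; have lies y : y \in root_sum t -> lie (vsval h) y \in root_sum t.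
  rewrite root_sumE => /nonzero_weight_partP yV; apply/nonzero_weight_partP => i wi.
  by rewrite coord_lie yV // mulr0.
have F1 : linear (fun y : subvs_of (root_sum t) =>
    vsproj (root_sum t) (lie (vsval h) (vsval y))).
  by move=> k x y; rewrite !linearP.
pose F1l := GRing.isLinear.Build _ _ _ _ _ F1.
pose F1L : {linear _ -> _} := HB.pack (fun y : subvs_of (root_sum t) =>
    vsproj (root_sum t) (lie (vsval h) (vsval y))) F1l.
have ker0 : lker (ad_root_sum h) == 0%VS.
  rewrite -subv0; apply/subvP => y; rewrite memv_ker memv0 (lfunE F1L) /=.
  move=> /eqP/(congr1 vsval); rewrite vsprojK ?lies ?subvsP // linear0 => hy.
  rewrite -(inj_eq val_inj) /= (coord_basis vb (memvf (vsval y))) big1 // => i _.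
  have := congr1 (coord v i) hy; rewrite coord_lie linear0 => /eqP.
  rewrite mulf_eq0; have [wi _|wi] := eqVneq (w i) 0.
    have : vsval y \in nonzero_weight_part by rewrite -root_sumE subvsP.
    by move=> /nonzero_weight_partP ->; rewrite ?scale0r.
  by rewrite (negPf (hr _ (roots_weight wi))) => /eqP ->; rewrite scale0r.
rewrite /ad_inv.
have -> : vsproj (root_sum t) (lie (vsval h) z) = ad_root_sum h (vsproj (root_sum t) z).
  by rewrite (lfunE F1L) /= vsprojK.
by rewrite lker0_lfunK // vsprojK.
Qed.

End RootDecomposition.

(** * Logarithmic forms and quadratic elements *)

Section LinearDifferentiability.
Variable K : numFieldType.

(** A linear map on row vectors is a finite sum of coordinate functions times fixed vectors. *)
Lemma linear_rV_differentiable (m : nat) (W : normedModType K)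
  (F : {linear 'rV[K]_m -> W}) u : differentiable F u.
Proof.
have -> : (F : _ -> _) = \sum_(i < m) (fun N : 'rV[K]_m => (N 0 i : K) *: F (delta_mx 0 i)).
  apply/funext => N; rewrite {1}(row_sum_delta N) linear_sum fct_sumE.
  by apply: eq_bigr => i _; rewrite linearZ.
apply: differentiable_sum => i.
exact/differentiableZl/differentiable_coord.
Qed.

Lemma coordsK (V : vectType K) (x : V) : vecof (vbasis {:V}) (coords x) = x.
Proof. exact/rVofK/vbasisP. Qed.

Variables (V W : vectType K).

Lemma in_coords_linear (F : {linear V -> W}) : linear (in_coords F).
Proof. by move=> k x y; rewrite /in_coords /coords /= !linearP. Qed.

Lemma extd_linear (F : {linear V -> W}) h x : extd F h x = F x.
Proof.
pose Gl := GRing.isLinear.Build _ _ _ _ _ (in_coords_linear F).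
pose G : {linear _ -> _} := HB.pack (in_coords F) Gl.
rewrite /extd -[in_coords F]/(G : _ -> _) diff_lin => [|u].
  by rewrite /= /in_coords /= !coordsK.
by apply: differentiable_continuous; exact: linear_rV_differentiable.
Qed.

End LinearDifferentiability.

Section LogarithmicForms.
Variables (K : numFieldType) (g : lieAlgType K) (t : {vspace g}).

Lemma dlogE (a : 'Hom(subvs_of t, K^o)) h x :
  dlog a h x = (a h : K)^-1 * (a x : K).
Proof. by rewrite /dlog extd_linear. Qed.

Lemma holomorphic_dlog (a : 'Hom(subvs_of t, K^o)) :
  Defs.roots a -> holomorphic_form (dlog a).
Proof.
move=> ar h hr; split=> [k x y|x].
  by rewrite !dlogE linearP mulrDr; congr (_ + _); exact: mulrCA.
(* In coordinates the form is a constant times the inverse of a linear function that is nonzero at a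
   regular point. *)
have E : in_coords ((dlog a)^~ x) = fun u =>
    ((a (vecof (vbasis {:subvs_of t}) u) : K)^-1 * (a x : K)) *: coords (1 : K^o).
  apply/funext => u; rewrite /in_coords /= dlogE /coords -[RHS]linearZ; congr rVof.
  by rewrite /GRing.scale /= mulr1.
rewrite E; apply: differentiableZl.
apply: differentiableM => //; apply: differentiableV; last by rewrite coordsK hr.
have F1 : linear (fun u => a (vecof (vbasis {:subvs_of t}) u) : K^o).
  by move=> k x' y'; rewrite !linearP.
pose F1l := GRing.isLinear.Build _ _ _ _ _ F1.
pose F1L : {linear _ -> K^o} := HB.pack (fun u => a (vecof (vbasis {:subvs_of t}) u)) F1l.
exact: (linear_rV_differentiable F1L).
Qed.

End LogarithmicForms.

(** * Quadratic elements as polynomial functions, and their symmetrisation *)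

Section Sym2.
Variables (K : numFieldType) (g : lieAlgType K).
Local Notation n := (\dim {:g}).
Local Notation v := (vbasis {:g}).
Implicit Types (s : symalg g) (B : 'Hom(g, K^o)).

Lemma sgen_linear : linear (@sgen K g).
Proof. exact: env_gen_linear. Qed.

Section PolyEval.
Variable B : 'Hom(g, K^o).

Let Blin : linear (B : g -> K^o). Proof. exact: linearP. Qed.
Let Bbr (x y : g) : (B x : K^o) * B y = B y * B x + B 0.
Proof. by rewrite linear0 addr0 mulrC. Qed.

Lemma poly_evalP k s s' : poly_eval (k *: s + s') B = k * poly_eval s B + poly_eval s' B.
Proof. exact: (env_lift_linear Blin Bbr). Qed.

Lemma poly_evalM s s' : poly_eval (s * s') B = poly_eval s B * poly_eval s' B.
Proof. exact: (env_lift_monoid_morphism Blin Bbr).2. Qed.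

Lemma poly_eval_gen x : poly_eval (sgen x) B = B x.
Proof. exact: (env_lift_gen Blin Bbr). Qed.

End PolyEval.

Lemma poly_eval0 B : poly_eval 0 B = 0.
Proof.
by have := poly_evalP B (-1) 0 0; rewrite scaler0 addr0 mulN1r addNr.
Qed.

Lemma poly_evalZ B k s : poly_eval (k *: s) B = k * poly_eval s B.
Proof. by rewrite -[k *: s]addr0 poly_evalP poly_eval0 addr0. Qed.

Lemma poly_evalD B s s' : poly_eval (s + s') B = poly_eval s B + poly_eval s' B.
Proof. by rewrite -[s]scale1r poly_evalP mul1r scale1r. Qed.

Lemma poly_eval_sum B I (r : seq I) (P : pred I) (F : I -> symalg g) :
  poly_eval (\sum_(i <- r | P i) F i) B = \sum_(i <- r | P i) poly_eval (F i) B.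
Proof.
apply: (big_morph (fun s => poly_eval s B)); last exact: poly_eval0.
exact: poly_evalD.
Qed.

Lemma sym2Z k s : sym2 s -> sym2 (k *: s).
Proof.
move=> [m [x [y ->]]]; exists m, (fun i => k *: x i), y.
rewrite scaler_sumr; apply: eq_bigr => i _; rewrite scalerAl.
by have := sgen_linear k (x i) 0; rewrite /sgen linear0 !addr0 => ->.
Qed.

Lemma sym2_prod x y : sym2 (sgen x * sgen y : symalg g).
Proof. by exists 1%N, (fun=> x), (fun=> y); rewrite big_ord1. Qed.

Lemma sym2D s s' : sym2 s -> sym2 s' -> sym2 (s + s').
Proof.
move=> [m [x [y ->]]] [m' [x' [y' ->]]].
exists (m + m')%N, (fun i => match fintype.split i with inl j => x j | inr j => x' j end),
  (fun i => match fintype.split i with inl j => y j | inr j => y' j end).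
rewrite big_split_ord /=; congr (_ + _); apply: eq_bigr => i _.
  by rewrite (unsplitK (inl i)).
by rewrite (unsplitK (inr i)).
Qed.

Lemma sym20 : sym2 (0 : symalg g).
Proof. by exists 0%N, (fun=> 0), (fun=> 0); rewrite big_ord0. Qed.

Lemma sym2_sum I (r : seq I) (F : I -> symalg g) :
  (forall i, sym2 (F i)) -> sym2 (\sum_(i <- r) F i).
Proof. by move=> FS; elim/big_ind: _ => //; [exact: sym20|exact: sym2D]. Qed.

Lemma sym2_coord s : sym2 s -> exists c : 'I_n -> 'I_n -> K,
  s = \sum_i \sum_j c i j *: (sgen v`_i * sgen v`_j).
Proof.
move=> [m [x [y ->]]].
exists (fun i j => \sum_(k < m) coord v i (x k) * coord v j (y k)).
transitivity (\sum_(k < m) \sum_i \sum_j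
    (coord v i (x k) * coord v j (y k)) *: (sgen v`_i * sgen v`_j : symalg g)).
  apply: eq_bigr => k _; rewrite {1}(coord_vbasis (memvf (x k))).
  rewrite {1}(coord_vbasis (memvf (y k))) /sgen !linear_sum mulr_suml.
  apply: eq_bigr => i _; rewrite mulr_sumr; apply: eq_bigr => j _.
  by rewrite !linearZ /= -scalerAl -scalerAr scalerA.
rewrite exchange_big; apply: eq_bigr => i _; rewrite exchange_big.
by apply: eq_bigr => j _; rewrite scaler_suml.
Qed.

(* Polarisation: the coefficients c of s satisfy c i j + c j i = 0. *)
Lemma sym2_poly_eval_eq0 s : sym2 s -> (forall B, poly_eval s B = 0) -> s = 0.
Proof.
move=> /sym2_coord[c sE] s0.
have ev B : \sum_i \sum_j c i j * (B v`_i * B v`_j : K) = 0.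
  rewrite -[RHS](s0 B) sE poly_eval_sum; apply: eq_bigr => i _.
  rewrite poly_eval_sum; apply: eq_bigr => j _.
  by rewrite poly_evalZ poly_evalM !poly_eval_gen.
pose e i : 'Hom(g, K^o) := linfun (coord v i : g -> K^o).
have eE i (j : 'I_n) : e i v`_j = (j == i)%:R.
  by rewrite lfunE /= coord_free ?(basis_free (vbasisP _)).
have sumE (F : 'I_n -> 'I_n -> K) k l :
    \sum_i \sum_j F i j * ((i == k)%:R * (j == l)%:R) = F k l.
  rewrite (bigD1 k) //= [X in _ + X]big1 => [|i ik]; last first.
    by rewrite big1 // => j _; rewrite (negPf ik) mul0r mulr0.
  rewrite (bigD1 l) //= big1 => [|j jl]; last by rewrite (negPf jl) !mulr0.
  by rewrite !eqxx !mulr1 !addr0.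
(* Evaluation at the dual basis vector [e k] isolates [c k k]; evaluation at [e k + e l] then
   isolates the mixed terms. *)
have cd k : c k k = 0.
  by rewrite -[RHS](ev (e k)) -[LHS](sumE c); apply: eq_bigr => i _;
    apply: eq_bigr => j _; rewrite !eE.
have csym k l : c k l + c l k = 0.
  transitivity (c k k + c k l + (c l k + c l l)); first by rewrite !cd addr0 add0r.
  rewrite -[RHS](ev (e k + e l)) -(sumE c k k) -(sumE c k l) -(sumE c l k) -(sumE c l l).
  rewrite -!big_split; apply: eq_bigr => i _; rewrite -!big_split; apply: eq_bigr => j _ /=.
  by rewrite !add_lfunE !eE; ring.
(* Adding [s] to its copy with the indices exchanged, and commuting the generators, leaves the
   coefficients [c i j + c j i]. *)
have s2 : 2%:R *: s = 0.
  rewrite scaler_nat mulr2n {1}sE exchange_big sE -big_split big1 // => i _.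
  rewrite -big_split big1 // => j _ /=.
  by rewrite [sgen v`_j * _]sgenC -scalerDl csym scale0r.
by move/eqP: s2; rewrite scaler_eq0 pnatr_eq0 => /eqP.
Qed.

Lemma symmetrisation_mul (br : g -> g -> g) x y :
  symmetrisation br (sgen x * sgen y) =
  2^-1 *: (env_gen br x * env_gen br y + env_gen br y * env_gen br x).
Proof.
pose X (i : 'I_2) := if i == 0 then x else y.
have := symmetrisation_prod br X; rewrite !big_ord_recl !big_ord0 mulr1 => ->.
congr (_ *: _).
pose p : 'S_2 := tperm ord0 ord_max.
have p1 : 1%g != p by apply/eqP => /permP/(_ ord0); rewrite tpermL perm1.
(* The identity and the transposition exhaust the permutations of two letters, by counting. *)
have S2 (s : 'S_2) : true = (s \in [set 1%g; p]%SET).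
  suff -> : [set 1%g; p]%SET = [set: 'S_2]%SET by rewrite inE.
  by apply/eqP; rewrite eqEcard finset.subsetT cards2 p1 cardsT card_Sn.
rewrite (eq_bigl _ _ S2) big_setU1 ?inE //= big_set1.
by rewrite !big_ord_recl !big_ord0 !mulr1 !perm1 /p tpermL (_ : lift _ _ = ord_max) ?tpermR //;
  exact: val_inj.
Qed.

End Sym2.

(** * The one-form varpi *)

Section Varpi.
Variables (K : numFieldType) (g : lieAlgType K) (t : {vspace g}).
Local Notation weight := ('Hom(subvs_of t, K^o)).
Variables (Rplus : set weight) (e f : weight -> g).
Hypotheses (g_simple : lie_simple g) (t_cartan : cartan_subalgebra t)
  (Rplus_pos : positive_system Rplus)
  (ef : forall a, Rplus a -> [/\ e a \in root_space a,
          f a \in root_space (- a) & lie (e a) (f a) = coroot a]).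
Implicit Types (a b : weight) (h : subvs_of t) (s : g).
Local Notation P := (fset_set Rplus).
Local Notation kap a := (killing (e a) (f a)).

Section Basis.
Local Notation n := (\dim {:g}).
Variables (v : n.-tuple g) (w : 'I_n -> weight).
Hypotheses (vb : basis_of fullv v)
  (vw : forall (i : 'I_n) h, lie (vsval h) v`_i = (w i h : K) *: v`_i).

Lemma Rplus_roots a : Rplus a -> Defs.roots a.
Proof. by have [+ _ _ _] := Rplus_pos; apply. Qed.

Lemma finite_Rplus : finite_set Rplus.
Proof. apply: sub_finite_set (finite_roots vb vw) => a; exact: Rplus_roots. Qed.

Lemma mem_Rplus a : a \in P -> Rplus a.
Proof. by rewrite (in_fset_set finite_Rplus) => /set_mem. Qed.

Lemma killing_ef a : Rplus a -> kap a = 2 / killing_dual a a.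
Proof.
move=> ap; have [ea fa efa] := ef ap.
exact: (killing_coroot g_simple t_cartan vb vw (Rplus_roots ap) ea fa efa).
Qed.

Lemma killing_ef_neq0 a : Rplus a -> kap a != 0.
Proof.
move=> ap; rewrite killing_ef // mulf_neq0 ?pnatr_eq0 // invr_neq0 //.
exact: (killing_dual_neq0 g_simple t_cartan vb vw (Rplus_roots ap)).
Qed.

(** The vector [f a] is nonzero because it pairs nontrivially with [e a]. *)
Lemma Rplus_opp_roots a : Rplus a -> Defs.roots (- a).
Proof.
move=> ap; have [_ fa _] := ef ap; have [a0 _] := Rplus_roots ap.
split; first by rewrite oppr_eq0.
apply: contraNneq (killing_ef_neq0 ap) => f0; move: fa.
by rewrite f0 memv0 => /eqP ->; rewrite linear0.
Qed.

(** Two positive roots are never opposite, so their sum is a nonzero weight. *)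
Lemma killing_ee a b : Rplus a -> Rplus b -> killing (e a) (e b) = 0.
Proof.
move=> ap bp; have [ea _ _] := ef ap; have [eb _ _] := ef bp.
apply: killing_orthogonal ea eb _; apply/eqP => /eqP; rewrite addr_eq0 => /eqP ab.
by have [_ _ + _] := Rplus_pos => /(_ b); rewrite -ab; apply.
Qed.

Lemma killing_ff a b : Rplus a -> Rplus b -> killing (f a) (f b) = 0.
Proof.
move=> ap bp; have [_ fa _] := ef ap; have [_ fb _] := ef bp.
apply: killing_orthogonal fa fb _; rewrite -opprD oppr_eq0.
apply/eqP => /eqP; rewrite addr_eq0 => /eqP ab.
by have [_ _ + _] := Rplus_pos => /(_ b); rewrite -ab; apply.
Qed.

Lemma killing_ef_neq a b : Rplus a -> Rplus b -> a != b -> killing (e a) (f b) = 0.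
Proof.
move=> ap bp ab; have [ea _ _] := ef ap; have [_ fb _] := ef bp.
by apply: killing_orthogonal ea fb _; rewrite subr_eq0.
Qed.

Lemma root_space_e a x : Rplus a -> x \in root_space a ->
  x = (killing x (f a) / kap a) *: e a.
Proof.
move=> ap; have [ea fa _] := ef ap.
exact: (root_space_line g_simple t_cartan vb vw (Rplus_roots ap)
  ea fa (killing_ef_neq0 ap)).
Qed.

Lemma root_space_f a x : Rplus a -> x \in root_space (- a) ->
  x = (killing x (e a) / kap a) *: f a.
Proof.
move=> ap; have [ea fa _] := ef ap; rewrite [kap a]killingC.
apply: (root_space_line g_simple t_cartan vb vw (Rplus_opp_roots ap) fa).
  by rewrite opprK.
by rewrite killingC killing_ef_neq0.
Qed.

(** For positive [a], the Killing-orthogonal projection of [s] to the plane of [e a] and [f a]. Both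
    vectors are isotropic, so each coefficient is a pairing with the other vector. *)
Definition root_component s a : g :=
  (killing s (f a) / kap a) *: e a + (killing s (e a) / kap a) *: f a.

Lemma killing_root_components s b : Rplus b ->
  killing (e b) (\sum_(a <- P) root_component s a) = killing (e b) s /\
  killing (f b) (\sum_(a <- P) root_component s a) = killing (f b) s.
Proof.
move=> bp; have bP : b \in P by rewrite (in_fset_set finite_Rplus) mem_set.
have k0 := killing_ef_neq0 bp.
rewrite !linear_sum !(bigD1_seq b) //= ?fset_uniq //.
have off (a : weight) : a \in P -> a != b ->
    killing (e b) (root_component s a) = 0 /\ killing (f b) (root_component s a) = 0.
  move=> /mem_Rplus ap ab; rewrite /root_component !linearD /= !killingZr.
  rewrite killing_ee // killing_ff // (killing_ef_neq bp ap) 1?eq_sym //.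
  by rewrite [killing (f b) (e a)]killingC (killing_ef_neq ap bp) // !mulr0 addr0.
rewrite !(big_seq_cond (fun a => a != b)) !big1 => [|a /andP[aP ab]|a /andP[aP ab]];
  try by have [] := off a aP ab.
rewrite !addr0 /root_component !linearD /= !killingZr killing_ee // killing_ff //.
rewrite [killing (f b) (e b)]killingC !divfK // mulr0 mulr0 addr0 add0r.
by split; exact: killingC.
Qed.

(** The remainder [r] is orthogonal to every [e b] and [f b]. By invariance K([h, r], v_i) is
    [- w i h] times K(r, v_i), which always vanishes; so [r] centralises [t]. *)
Lemma cartan_component s : s - \sum_(a <- P) root_component s a \in t.
Proof.
set r := s - _; have [_ _ tc] := t_cartan; apply: tc => h' h't.
rewrite -(vsprojK h't); move: (vsproj t h') => h.
have eq0 b : Rplus b -> killing r (e b) = 0 /\ killing r (f b) = 0.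
  move=> bp; have [Ee Ef] := killing_root_components s bp.
  by rewrite ![killing r _]killingC !linearB /= Ee Ef !subrr.
apply: (killing_nondegenerate g_simple t_cartan vb vw).
apply: (linear_basis_eq0 vb (F := killing (lie (vsval h) r))) => i /=.
rewrite lieC killingNl killing_invariant vw killingZr.
have vi := root_space_basis vw i.
have [->|wi] := eqVneq (w i) 0; first by rewrite zero_lfunE mul0r oppr0.
have [_ pm _ _] := Rplus_pos; have [wp|wp] := pm _ (roots_weight vb vw wi).
  by rewrite (root_space_e wp vi) killingZr (eq0 _ wp).1 !mulr0 oppr0.
rewrite -[w i]opprK in vi.
by rewrite (root_space_f wp vi) killingZr (eq0 _ wp).2 !mulr0 oppr0.
Qed.

Lemma varpi_basisE (B : 'Hom(g, K^o)) h x : regular h ->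
  varpi B h x = \sum_(a <- P)
    killing_dual a a * (dlog a h x : K) * ((B (e a) : K) * (B (f a) : K)).
Proof.
move=> hr; set s := sharp B; rewrite /varpi -/s extd_linear /=.
have sB y : killing s y = B y := sharpK g_simple t_cartan vb vw B y.
(* The preimage of [x, s] under [ad h]: on a root component [ad x] and [ad h] differ only by the
   factor [a x / a h], and [ad x] kills the part of [s] in [t]. *)
pose z := \sum_(a <- P) ((a x : K) / (a h : K)) *: root_component s a.
have lieE (u : subvs_of t) a : Rplus a -> lie (vsval u) (root_component s a) =
    (a u : K) *: ((killing s (f a) / kap a) *: e a - (killing s (e a) / kap a) *: f a).
  move=> ap; have [ea fa _] := ef ap; rewrite linearD !linearZ /=.
  rewrite (root_spaceP _ _ ea) (root_spaceP _ _ fa) opp_lfunE.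
  rewrite scaleNr scalerDr -scalerN; congr (_ + _);
    rewrite scalerA [RHS]scalerA; congr (_ *: _); exact: mulrC.
have -> : lie (vsval x) s = lie (vsval h) z.
  have [tab _ _] := t_cartan.
  rewrite -{1}(subrK (\sum_(a <- P) root_component s a) s) linearD /=.
  rewrite (tab _ _ (subvsP x) (cartan_component s)) add0r /z !linear_sum.
  rewrite !big_seq; apply: eq_bigr => a /mem_Rplus ap; rewrite linearZ /= !lieE //.
  by rewrite scalerA divfK // hr //; exact: Rplus_roots.
rewrite (ad_inv_lie vb vw hr); last first.
  rewrite /z big_seq memv_suml // => a /mem_Rplus ap; have [ea fa _] := ef ap.
  rewrite memvZ // memvD // memvZ //.
    exact: (subvP (root_space_sub_root_sum vb vw (Rplus_roots ap))).
  exact: (subvP (root_space_sub_root_sum vb vw (Rplus_opp_roots ap))).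
rewrite /z linear_sum !big_seq; apply: eq_bigr => a /mem_Rplus ap.
rewrite linearZ /= /root_component linearD /= !killingZr !sB dlogE killing_ef //.
have a0 : killing_dual a a != 0.
  exact: (killing_dual_neq0 g_simple t_cartan vb vw (Rplus_roots ap)).
have ah : (a h : K) != 0 by apply: hr; exact: Rplus_roots.
(* Here [p], [q], [k], [u], [u'] stand for [a x], [a h], K(a, a), [B (e a)], [B (f a)]; the two
   equal terms cancel the 2 of K(e_a, f_a) = 2 / K(a, a). *)
have E (p q k u u' : K) : q != 0 -> k != 0 ->
    p / q * (u' / (2 / k) * u + u / (2 / k) * u') = k * (q^-1 * p) * (u * u').
  by move=> q0 k0; field; rewrite q0 k0.
exact: E.
Qed.

End Basis.

(** * The representing form: existence, uniqueness and symmetrisation *)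

Lemma Rplus_finite : finite_set Rplus.
Proof. by have [v [w [vb vw]]] := weight_basis t_cartan; exact: (finite_Rplus vb vw). Qed.

Lemma varpiE (B : 'Hom(g, K^o)) h x : regular h ->
  varpi B h x = \sum_(a <- P)
    killing_dual a a * (dlog a h x : K) * ((B (e a) : K) * (B (f a) : K)).
Proof. by have [v [w [vb vw]]] := weight_basis t_cartan; exact: (varpi_basisE vb vw). Qed.

(** The explicit representative of [varpi]. Its coefficient is K(a, a) itself; the factor one half
    of the final formula comes from symmetrising [e a] times [f a]. *)
Definition root_form : one_form t (symalg g) := fun h x =>
  \sum_(a <- P) otimes (killing_dual a a *: (sgen (e a) * sgen (f a))) (dlog a) h x.

Lemma root_form_sum h x : root_form h x = \sum_(i < size P)
  otimes (killing_dual P`_i P`_i *: (sgen (e P`_i) * sgen (f P`_i))) (dlog P`_i) h x.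
Proof. by rewrite /root_form (big_nth 0) big_mkord. Qed.

Lemma sym2_tensor_forms (omega : one_form t (symalg g)) h x :
  in_tensor_forms (@sym2 K g) omega -> regular h -> sym2 (omega h x).
Proof.
move=> [m [u [eta [u2 _ omE]]]] hr; rewrite omE //.
by apply: sym2_sum => i; exact/sym2Z/u2.
Qed.

Lemma root_form_represents : represents_varpi root_form.
Proof.
split=> [|h x hr B].
  exists (size P), (fun i : 'I_(size P) => killing_dual P`_i P`_i *:
    (sgen (e P`_i) * sgen (f P`_i))), (fun i : 'I_(size P) => dlog P`_i).
  split=> [i|i|h x _]; [exact/sym2Z/sym2_prod | | exact: root_form_sum].
  apply: holomorphic_dlog; apply: Rplus_roots; apply: set_mem.
  by rewrite -(in_fset_set Rplus_finite) mem_nth.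
rewrite varpiE // poly_eval_sum; apply: eq_bigr => a _.
rewrite /otimes !poly_evalZ poly_evalM !poly_eval_gen.
by rewrite mulrA [X in X * _]mulrC.
Qed.

(** At a regular point the difference is quadratic and induces the zero polynomial function. *)
Lemma represents_varpi_unique (omega omega' : one_form t (symalg g)) h x :
  represents_varpi omega -> represents_varpi omega' -> regular h ->
  omega h x = omega' h x.
Proof.
move=> [om ev] [om' ev'] hr; apply/subr0_eq; apply: sym2_poly_eval_eq0 => [|B].
  by rewrite -scaleN1r; apply: sym2D; [|apply: sym2Z]; exact: sym2_tensor_forms.
by rewrite -scaleN1r poly_evalD poly_evalZ ev // ev' // mulN1r subrr.
Qed.

Lemma symmetrisation_root_form h x :
  symmetrisation (@lie _ g) (root_form h x) =
  \sum_(a \in Rplus) otimes ((killing_dual a a / 2) *: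
      (ugen (e a) * ugen (f a) + ugen (f a) * ugen (e a))) (dlog a) h x.
Proof.
rewrite (fsbig_finite _ _ Rplus_finite) linear_sum; apply: eq_bigr => a _.
by rewrite /otimes ![in LHS]linearZ /= symmetrisation_mul [X in _ *: X = _]scalerA.
Qed.

End Varpi.

Lemma in_tensor_forms_linear (K : numFieldType) (g : lieAlgType K) (t : {vspace g})
    (M M' : lmodType K) (N : set M) (F : {linear M -> M'}) (omega : one_form t M) :
  in_tensor_forms N omega -> in_tensor_forms setT (fun h x => F (omega h x)).
Proof.
move=> [m [u [eta [_ etah omE]]]]; exists m, (F \o u), eta; split=> // h x hr.
by rewrite omE // linear_sum; apply: eq_bigr => i _; rewrite /otimes linearZ.
Qed.

Theorem proposition19 (R : realType) (g : lieAlgType R[i]) (t : {vspace g})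
    (Rplus : set 'Hom(subvs_of t, R[i]^o)) (e f : 'Hom(subvs_of t, R[i]^o) -> g)
    (g_simple : lie_simple g) (t_cartan : cartan_subalgebra t)
    (Rplus_pos : positive_system Rplus)
    (ef : forall a, Rplus a -> [/\ e a \in root_space a,
            f a \in root_space (- a) & lie (e a) (f a) = coroot a]) :
  (exists omega : one_form t (symalg g), represents_varpi omega) /\
  (forall omega : one_form t (symalg g), represents_varpi omega ->
     let phi_omega : one_form t (uea g) :=
       fun h x => symmetrisation (@lie _ g) (omega h x) in
     in_tensor_forms setT phi_omega /\
     forall h x, regular h ->
       phi_omega h x = \sum_(a \in Rplus)
         otimes ((killing_dual a a / 2) *:
                   (ugen (e a) * ugen (f a) + ugen (f a) * ugen (e a)))
                (dlog a) h x).
Proof.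
have rep := root_form_represents g_simple t_cartan Rplus_pos ef.
split=> [|omega om phi_omega]; first by exists (root_form Rplus e f).
split=> [|h x hr].
  exact: (in_tensor_forms_linear (symmetrisation (@lie _ g)) om.1).
(* By uniqueness an arbitrary representative may be replaced by [root_form] at the regular point
   [h]. *)
rewrite /phi_omega (represents_varpi_unique x om rep hr).
exact: (symmetrisation_root_form e f t_cartan Rplus_pos).
Qed.
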